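(* Let $r\in\mathbb{R}$ and $q\in\mathbb{C}$, and let $\nabla$ be the $\mathrm{SU}(3)$-invariant metric affine connection with totally skew-symmetric torsion on $\mathbb{S}^5$ given by $$\begin{aligned}\nabla_XY=\ &\nabla^g_XY+r\big(\Phi(X,Y)\,\xi-\eta(X)\psi(Y)+\eta(Y)\psi(X)\big)\\&+\mathrm{Re}(q)\big(\eta(Y)\psi(\widehat\psi(X))-\eta(X)\psi(\widehat\psi(Y))+\Phi(\widehat\psi(X),Y)\xi\big)\\&+\mathrm{Im}(q)\big(\eta(X)\widehat\psi(Y)-\eta(Y)\widehat\psi(X)+g(\widehat\psi(X),Y)\xi\big).\end{aligned}$$ Then $$\mathrm{Sym}(\mathrm{Ric}^\nabla)=\big(4-2(r^2+|q|^2)\big)\,g-2(r^2+|q|^2)\,\eta\otimes\eta.$$ In particular, $(\mathbb{S}^5,g,\nabla)$ is not $\nabla$-Einstein for any $\mathrm{SU}(3)$-invariant metric affine connection $\nabla$ unless $\nabla=\nabla^g$.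
   Context: $\mathrm{SU}(3)$ acts on the unit sphere $\mathbb{S}^5\subset\mathbb{C}^3$ by matrix multiplication; write $\tau_\sigma(p)=\sigma p$. For a vector field $X$, $\tau_\sigma(X)_p=(\tau_\sigma)_*(X_{\sigma^{-1}p})$. An affine connection $\nabla$ is $\mathrm{SU}(3)$-invariant if $\tau_\sigma(\nabla_XY)=\nabla_{\tau_\sigma(X)}\tau_\sigma(Y)$ for all $\sigma\in\mathrm{SU}(3)$ and all vector fields $X,Y$. $g$ is the canonical Riemannian metric of constant sectional curvature $1$ and $\nabla^g$ its Levi-Civita connection. $\nabla$ is metric if $\nabla g=0$ (its torsion need not vanish). Its torsion is $T^\nabla(X,Y)=\nabla_XY-\nabla_YX-[X,Y]$, and $\nabla$ has totally skew-symmetric torsion if $\omega_\nabla(X,Y,Z)=g(T^\nabla(X,Y),Z)$ is a $3$-form. Sasakian structure: $\xi_z=-\mathbf{i}z$; with $N$ the unit outward normal of $\mathbb{S}^5$ in $\mathbb{C}^3$, $\psi$ and $\eta$ are determined by the decomposition $\mathbf{i}X=\psi(X)+\eta(X)N$ into tangent and normal parts; $\Phi(X,Y)=g(X,\psi(Y))$. The tensor $\widehat\psi$: let $\mathbb{O}=\mathrm{Span}_{\mathbb{R}}\{1,e_1,\dots,e_7\}$ be the octonions with $e_i^2=-1$, $e_ie_j=-e_je_i$ ($i\ne j$), $e_1e_2=e_4$, and such that whenever $e_ie_j=e_k$ then $e_{i+1}e_{j+1}=e_{k+1}$ and $e_{2i}e_{2j}=e_{2k}$ (indices modulo $7$, in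 $\{1,\dots,7\}$). Identify $\mathbb{C}$ with $\mathrm{Span}\{1,e_7\}$ (with $\mathbf{i}=e_7$) and $\mathbb{C}^3$ with $\mathrm{Span}\{e_1,\dots,e_6\}$ via $(z_1,z_2,z_3)\leftrightarrow z_1e_1+z_2e_2+z_3e_4$. On the unit sphere $\mathbb{S}^6\subset\mathrm{Im}(\mathbb{O})=\mathrm{Span}\{e_1,\dots,e_7\}$ let $J$ be the almost complex structure $J(X)=\mathrm{Im}(pX)$ for $X\in T_p\mathbb{S}^6$ (octonion product, $\mathrm{Im}$ the imaginary part). View $\mathbb{S}^5\subset\mathbb{C}^3$ as the hypersurface $x_7=0$ of $\mathbb{S}^6$, with unit normal field $\nu=-\partial/\partial x_7$ (i.e. $\nu=-e_7$). For $X$ tangent to $\mathbb{S}^5$, $\widehat\psi(X)$ is the tangent part in the decomposition $J(X)=\widehat\psi(X)+\eta(X)\nu$ (the coefficient of $\nu$ coincides with the $\eta$ above). Curvature: $R^\nabla(X,Y)Z=\nabla_X\nabla_YZ-\nabla_Y\nabla_XZ-\nabla_{[X,Y]}Z$, $\mathrm{Ric}^\nabla(Y,Z)=\mathrm{tr}(X\mapsto R^\nabla(X,Y)Z)$, $s^\nabla$ is the $g$-trace of $\mathrm{Ric}^\nabla$, and $\mathrm{Sym}$ denotes the symmetric part. $(M,g,\nabla)$ is $\nabla$-Einstein if $\nabla$ is metric, has totally skew-symmetric torsion and $\mathrm{Sym}(\mathrm{Ric}^\nabla)=\frac{s^\nabla}{\dim M}g$. *)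

(* Defs.v *)
From HB Require Import structures.
From mathcomp Require Import all_boot all_order all_algebra spectral complex.
From mathcomp Require Import all_classical all_reals all_analysis.
From mathcomp Require Import ring lra.

Set Implicit Arguments.
Unset Strict Implicit.
Unset Printing Implicit Defensive.

Import Order.TTheory GRing.Theory Num.Theory.
Import numFieldNormedType.Exports.

Local Open Scope classical_set_scope.
Local Open Scope ring_scope.

(* 'rV[R]_8 is the space of octonions: index 0 is the unit, index i is e_i.
   'rV[R]_6 is Span{e_1, ..., e_6}, so index i there is e_(i+1); it is the real
   form of C^3 = 'cV[R[i]]_3 and the ambient space of the sphere. *)

Section Octonions.
Variable R : realType.

(* e_k, with k taken modulo 7 in {1, ..., 7}; in particular e_0 means e_7 *)
Definition oe (k : nat) : 'rV[R]_8 := delta_mx 0 (inord ((k + 6) %% 7).+1).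

Definition o1 : 'rV[R]_8 := delta_mx 0 0.

(* For j - i = 1, 2, 4 modulo 7 the product e_i e_j is +e_k; the three families
   are the orbit of e_1 e_2 = e_4 under i -> i + 1 and i -> 2 i, and the other
   three follow by anticommutation.  See omul_e1e2, omul_shift and omul_double. *)
Definition omul_basis (i j : nat) : 'rV[R]_8 :=
  if i == 0%N then delta_mx 0 (inord j) else
  if j == 0%N then delta_mx 0 (inord i) else
  match ((j + 7 - i) %% 7)%N with
  | 0 => - o1
  | 1 => oe (i + 3)%N
  | 2 => oe (i + 6)%N
  | 4 => oe (i + 5)%N
  | 3 => - oe (i + 1)%N
  | 5 => - oe (i + 4)%N
  | _ => - oe (i + 2)%N
  end.

Definition omul (a b : 'rV[R]_8) : 'rV[R]_8 :=
  \sum_(i < 8) \sum_(j < 8) (a 0 i * b 0 j) *: omul_basis i j.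

Definition oIm (a : 'rV[R]_8) : 'rV[R]_8 := a - a 0 0 *: o1.

Definition oemb (u : 'rV[R]_6) : 'rV[R]_8 :=
  row_mx (row_mx (0 : 'rV_1) u) (0 : 'rV_1).

Definition orestr (a : 'rV[R]_8) : 'rV[R]_6 :=
  @rsubmx R 1 1 6 (@lsubmx R 1 (1 + 6) 1 a).

Lemma omul_delta (i j : 'I_8) :
  omul (delta_mx 0 i) (delta_mx 0 j) = omul_basis i j.
Proof.
rewrite /omul (bigD1 i) //= (bigD1 j) //= !big1 ?addr0 //.
- by rewrite !mxE !eqxx mul1r scale1r.
- move=> k /negPf nk; rewrite big1 // => l _.
  by rewrite !mxE nk andbF mul0r scale0r.
- by move=> k /negPf nk; rewrite !mxE nk andbF mulr0 scale0r.
Qed.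

Let oidx (k : nat) : nat := ((k + 6) %% 7).+1.

Let otab (i j : nat) : bool * nat :=
  match ((oidx j + 7 - oidx i) %% 7)%N with
  | 0 => (true, 0)
  | 1 => (false, oidx (oidx i + 3))
  | 2 => (false, oidx (oidx i + 6))
  | 4 => (false, oidx (oidx i + 5))
  | 3 => (true, oidx (oidx i + 1))
  | 5 => (true, oidx (oidx i + 4))
  | _ => (true, oidx (oidx i + 2))
  end%N.

Let oidx_lt k : (oidx k < 8)%N.
Proof. by rewrite /oidx ltnS ltn_mod. Qed.

Let omul_oe i j :
  omul (oe i) (oe j) =
  (-1) ^+ (otab i j).1 *: delta_mx 0 (inord (otab i j).2).
Proof.
rewrite /oe omul_delta -!/(oidx _) /omul_basis !inordK ?oidx_lt //=.
have z : inord 0 = 0 :> 'I_8 by apply: val_inj; rewrite /= inordK.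
rewrite /otab; case: (_ %% _)%N => [|[|[|[|[|[|n]]]]]] /=;
  by rewrite ?expr0 ?expr1 ?scaleN1r ?scale1r ?z.
Qed.

Let otab_lt i j : ((otab i j).2 < 8)%N.
Proof.
rewrite /otab; case: (_ %% _)%N => [|[|[|[|[|[|n]]]]]] //=; exact: oidx_lt.
Qed.

Let omul_oe_eq i j k :
  omul (oe i) (oe j) = oe k <-> otab i j = (false, oidx k).
Proof.
rewrite omul_oe; split=> [|->]; last by rewrite expr0 scale1r.
move=> /rowP /(_ (inord (oidx k))); rewrite !mxE !eqxx /=.
have -> : (inord (oidx k) == inord (otab i j).2 :> 'I_8) = ((otab i j).2 == oidx k).
  by rewrite -val_eqE /= !inordK ?oidx_lt ?otab_lt // eq_sym.
case: (otab i j) => b t /=; case: eqP => [-> |_]; last first.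
  by move/eqP; rewrite mulr0 eq_sym oner_eq0.
case: b => //= /eqP; rewrite expr1 mulr1 -subr_eq0 -opprD oppr_eq0.
by rewrite -(natrD _ 1 1) pnatr_eq0.
Qed.

Let oidx_mod k : oidx k = oidx (k %% 7).
Proof. by rewrite /oidx modnDml. Qed.

Let otab_mod i j : otab i j = otab (i %% 7) (j %% 7).
Proof. by rewrite /otab (oidx_mod i) (oidx_mod j). Qed.

Let oiota (P : nat -> nat -> nat -> bool) :
  all (fun i => all (fun j => all (P i j) (iota 0 7)) (iota 0 7)) (iota 0 7) ->
  forall i j k, P (i %% 7)%N (j %% 7)%N (k %% 7)%N.
Proof.
move=> aP i j k; have m l : (l %% 7)%N \in iota 0 7.
  by rewrite mem_iota ltn_mod.
by move: aP => /allP/(_ _ (m i))/allP/(_ _ (m j))/allP/(_ _ (m k)).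
Qed.

Lemma omul_sq i : omul (oe i) (oe i) = - o1.
Proof.
rewrite omul_oe /otab addKn /= expr1 scaleN1r; congr (- delta_mx _ _).
by apply: val_inj; rewrite /= inordK.
Qed.

Lemma omul_anti i j : i != j %[mod 7] -> omul (oe i) (oe j) = - omul (oe j) (oe i).
Proof.
move=> nij; rewrite !omul_oe.
have := @oiota (fun i j _ => (i != j) ==>
  (((otab i j).1 == ~~ (otab j i).1) && ((otab i j).2 == (otab j i).2))) isT i j 0.
rewrite nij -!otab_mod /= => /andP[/eqP -> /eqP ->].
by case: (otab j i).1; rewrite /= ?expr0 ?expr1 ?scaleN1r ?scale1r ?opprK.
Qed.

Lemma omul_e1e2 : omul (oe 1) (oe 2) = oe 4.
Proof. exact/omul_oe_eq. Qed.

Lemma omul_e7 :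
  [/\ omul (oe 7) (oe 1) = oe 3, omul (oe 7) (oe 2) = oe 6 &
      omul (oe 7) (oe 4) = oe 5].
Proof. by split; apply/omul_oe_eq. Qed.

Lemma omul_shift i j k :
  omul (oe i) (oe j) = oe k -> omul (oe i.+1) (oe j.+1) = oe k.+1.
Proof.
rewrite !omul_oe_eq => /eqP h; apply/eqP; move: h.
have := @oiota (fun i j k => (otab i j == (false, oidx k)) ==>
  (otab i.+1 j.+1 == (false, oidx k.+1))) isT i j k.
rewrite -!oidx_mod -otab_mod => /implyP h /h.
rewrite otab_mod [otab i.+1 _]otab_mod [oidx (k %% 7).+1]oidx_mod [oidx k.+1]oidx_mod.
have m l : ((l %% 7).+1 %% 7 = l.+1 %% 7)%N by rewrite -addn1 modnDml addn1.
by rewrite !m.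
Qed.

Lemma omul_double i j k :
  omul (oe i) (oe j) = oe k -> omul (oe (2 * i)) (oe (2 * j)) = oe (2 * k).
Proof.
rewrite !omul_oe_eq => /eqP h; apply/eqP; move: h.
have := @oiota (fun i j k => (otab i j == (false, oidx k)) ==>
  (otab (2 * i) (2 * j) == (false, oidx (2 * k)))) isT i j k.
rewrite -!oidx_mod -otab_mod => /implyP h /h.
rewrite otab_mod [otab (2 * i) _]otab_mod [oidx (2 * (k %% 7))]oidx_mod.
by rewrite [oidx (2 * k)]oidx_mod !modnMmr.
Qed.

End Octonions.

Section ComplexStructure.
Variable R : realType.

(* (z_1, z_2, z_3) <-> z_1 e_1 + z_2 e_2 + z_3 e_4 with i = e_7; since
   e_7 e_1 = e_3, e_7 e_2 = e_6 and e_7 e_4 = e_5, the imaginary parts are the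
   coordinates along e_3, e_6 and e_5.  See oemb_ofC. *)
Definition ofC (z : 'cV[R[i]]_3) : 'rV[R]_6 :=
  \row_j [:: complex.Re (z (inord 0) 0); complex.Re (z (inord 1) 0);
             complex.Im (z (inord 0) 0); complex.Re (z (inord 2) 0);
             complex.Im (z (inord 2) 0); complex.Im (z (inord 1) 0)]`_j.

Definition toC (u : 'rV[R]_6) : 'cV[R[i]]_3 :=
  \col_k [:: Complex (u 0 (inord 0)) (u 0 (inord 2));
             Complex (u 0 (inord 1)) (u 0 (inord 5));
             Complex (u 0 (inord 3)) (u 0 (inord 4))]`_k.

Definition muli (u : 'rV[R]_6) : 'rV[R]_6 := ofC ('i%C *: toC u).

Definition dot n (u v : 'rV[R]_n) : R := (u *m v^T) 0 0.

Definition act (s : 'M[R[i]]_3) (u : 'rV[R]_6) : 'rV[R]_6 := ofC (s *m toC u).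

Definition SU3 : set 'M[R[i]]_3 := [set s | s \is unitarymx /\ \det s = 1].

End ComplexStructure.

Section Sphere.
Variable R : realType.

Definition S5 := {p : 'rV[R]_6 | dot p p == 1}.

Lemma dot_oe1 : dot (delta_mx 0 0 : 'rV[R]_6) (delta_mx 0 0) == 1.
Proof. by rewrite /dot trmx_delta mul_delta_mx mxE !eqxx. Qed.

(* The radial retraction x |-> x / |x| of R^6 \ {0} onto the sphere. *)
Definition retr (x : 'rV[R]_6) : S5 :=
  insubd (Sub (delta_mx 0 0) dot_oe1 : S5) ((Num.sqrt (dot x x))^-1 *: x).

Fixpoint Ck_on (V W : normedModType R) (k : nat) (U : set V) (f : V -> W) : Prop :=
  match k with
  | 0 => forall x, U x -> {for x, continuous f}
  | k'.+1 => (forall x, U x -> differentiable f x) /\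
             (forall v : V, Ck_on k' U (fun x => 'D_v f x))
  end.

(* Smoothness on an embedded submanifold: existence of a smooth extension to a
   neighbourhood. *)
Definition smooth (W : normedModType R) (f : S5 -> W) : Prop :=
  exists (U : set 'rV[R]_6) (F : 'rV[R]_6 -> W),
    [/\ open U, forall p : S5, U (val p),
        forall k, Ck_on k U F & forall p : S5, F (val p) = f p].

(* Derivative at p along a vector v tangent at p, computed with the extension
   of f that is constant along rays; every smooth extension gives the same value. *)
Definition deriv_at (W : normedModType R) (f : S5 -> W) (p : S5) (v : 'rV[R]_6) : W :=
  'D_v (f \o retr) (val p).

Definition field := S5 -> 'rV[R]_6.

Definition vector_field (X : field) : Prop :=
  smooth X /\ forall p, dot (X p) (val p) = 0.

Definition D (W : normedModType R) (X : field) (f : S5 -> W) : S5 -> W :=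
  fun p => deriv_at f p (X p).

(* Here D X Y differentiates the R^6-valued function Y, i.e. its components
   Y(x_i); so component i of lie X Y is X(Y(x_i)) - Y(X(x_i)). *)
Definition lie (X Y : field) : field := fun p => D X Y p - D Y X p.

(* The round metric: the restriction of the Euclidean inner product. *)
Definition g (X Y : field) : S5 -> R^o := fun p => dot (X p) (Y p).

Definition tproj (p : S5) (v : 'rV[R]_6) : 'rV[R]_6 := v - dot v (val p) *: val p.

Definition tfield (v : 'rV[R]_6) : field := fun p => tproj p v.

End Sphere.

Section Connections.
Variable R : realType.
Local Notation S5 := (S5 R).
Local Notation field := (field R).
Local Notation connection := (field -> field -> field).
Implicit Types (nabla : connection) (X Y Z : field).

(* A connection is a total map on arbitrary R^6-valued functions of which only
   the values on vector fields are meaningful. *)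
Record affine_connection nabla : Prop := {
  conn_vf : forall X Y,
    vector_field X -> vector_field Y -> vector_field (nabla X Y);
  conn_addl : forall X X' Y,
    vector_field X -> vector_field X' -> vector_field Y ->
    nabla (fun p => X p + X' p) Y = (fun p => nabla X Y p + nabla X' Y p);
  conn_scalel : forall (f : S5 -> R^o) X Y,
    smooth f -> vector_field X -> vector_field Y ->
    nabla (fun p => f p *: X p) Y = (fun p => f p *: nabla X Y p);
  conn_addr : forall X Y Y',
    vector_field X -> vector_field Y -> vector_field Y' ->
    nabla X (fun p => Y p + Y' p) = (fun p => nabla X Y p + nabla X Y' p);
  conn_leibniz : forall (f : S5 -> R^o) X Y,
    smooth f -> vector_field X -> vector_field Y ->
    nabla X (fun p => f p *: Y p) =
      (fun p => (D X f p : R) *: Y p + f p *: nabla X Y p) }.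

Definition eq_connection nabla nabla' : Prop :=
  forall X Y, vector_field X -> vector_field Y -> nabla X Y = nabla' X Y.

Definition metric nabla : Prop :=
  forall X Y Z, vector_field X -> vector_field Y -> vector_field Z ->
  forall p, D X (g Y Z) p = g (nabla X Y) Z p + g Y (nabla X Z) p.

Definition torsion nabla X Y : field :=
  fun p => nabla X Y p - nabla Y X p - lie X Y p.

Definition levi_civita nabla : Prop :=
  [/\ affine_connection nabla, metric nabla &
      forall X Y, vector_field X -> vector_field Y ->
      forall p, torsion nabla X Y p = 0].

(* C^oo-linearity in the first argument, hence in all of them by alternation. *)
Definition three_form (w : field -> field -> field -> S5 -> R^o) : Prop :=
  forall X Y Z, vector_field X -> vector_field Y -> vector_field Z ->
  [/\ smooth (w X Y Z),
      forall p, w Y X Z p = - w X Y Z p,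
      forall p, w X Z Y p = - w X Y Z p,
      forall X' p, vector_field X' ->
        w (fun x => X x + X' x) Y Z p = w X Y Z p + w X' Y Z p &
      forall (f : S5 -> R^o) p, smooth f ->
        w (fun x => f x *: X x) Y Z p = f p * w X Y Z p].

Definition skew_torsion nabla : Prop :=
  three_form (fun X Y Z => g (torsion nabla X Y) Z).

(* For s in SU(3) the point s^-1 p is on the sphere, so retr does not move it;
   it only serves to produce a term of type S5.  See retr_act. *)
Definition tau (s : 'M[R[i]]_3) X : field :=
  fun p => act s (X (retr (act (invmx s) (val p)))).

Definition su3_invariant nabla : Prop :=
  forall s, SU3 s -> forall X Y, vector_field X -> vector_field Y ->
  tau s (nabla X Y) = nabla (tau s X) (tau s Y).

Definition curv nabla X Y Z : field :=
  fun p => nabla X (nabla Y Z) p - nabla Y (nabla X Z) p - nabla (lie X Y) Z p.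

(* The trace of the endomorphism v |-> R(v, Y)Z of the tangent space at p,
   extended by 0 on the normal line; tfield v extends the tangent part of v
   at p to a vector field. *)
Definition Ric nabla Y Z : S5 -> R :=
  fun p => \tr (lin1_mx (fun v => curv nabla (tfield v) Y Z p)).

(* The trace with respect to g, computed with the projections of the standard
   basis of R^6; it agrees with the sum over any orthonormal basis of the
   tangent space at p.  See tproj_frame. *)
Definition scal nabla : S5 -> R :=
  fun p => \sum_(i < 6) Ric nabla (tfield (delta_mx 0 i)) (tfield (delta_mx 0 i)) p.

Definition SymRic nabla Y Z : S5 -> R :=
  fun p => (Ric nabla Y Z p + Ric nabla Z Y p) / 2.

Definition Einstein nabla : Prop :=
  [/\ metric nabla, skew_torsion nabla &
      forall Y Z, vector_field Y -> vector_field Z ->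
      forall p, SymRic nabla Y Z p = scal nabla p / 5 * g Y Z p].

End Connections.

Section Sasakian.
Variable R : realType.
Local Notation S5 := (S5 R).
Implicit Types (p : S5) (u v : 'rV[R]_6).

Definition xi p : 'rV[R]_6 := - muli (val p).

(* The unit outward normal at p is p itself. *)
Definition eta_form p u : R := dot (muli u) (val p).

Definition psi p u : 'rV[R]_6 := muli u - eta_form p u *: val p.

Definition Phi p u v : R := dot u (psi p v).

Definition Jmap p u : 'rV[R]_8 := oIm (omul (oemb (val p)) (oemb u)).

Definition nu : 'rV[R]_8 := - oe R 7.

(* J(X) minus its component along nu; see Jmap_decomp, where the coefficient of
   nu comes out as eta_form. *)
Definition psihat p u : 'rV[R]_6 :=
  orestr (Jmap p u - dot (Jmap p u) nu *: nu).

Definition nabla_rq (nablag : field R -> field R -> field R) (r : R) (q : R[i])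
    (X Y : field R) : field R := fun p =>
  let x := X p in let y := Y p in
  nablag X Y p
  + r *: (Phi p x y *: xi p - eta_form p x *: psi p y + eta_form p y *: psi p x)
  + complex.Re q *: (eta_form p y *: psi p (psihat p x) - eta_form p x *: psi p (psihat p y)
                     + Phi p (psihat p x) y *: xi p)
  + complex.Im q *: (eta_form p x *: psihat p y - eta_form p y *: psihat p x
                     + dot (psihat p x) y *: xi p).

End Sasakian.

Section Validation.
Variable R : realType.

Lemma omulDl (a b c : 'rV[R]_8) : omul (a + b) c = omul a c + omul b c.
Proof.
rewrite /omul -big_split; apply: eq_bigr => i _; rewrite -big_split.
by apply: eq_bigr => j _; rewrite mxE mulrDl scalerDl.
Qed.

Lemma omulZl k (a b : 'rV[R]_8) : omul (k *: a) b = k *: omul a b.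
Proof.
rewrite /omul scaler_sumr; apply: eq_bigr => i _; rewrite scaler_sumr.
by apply: eq_bigr => j _; rewrite mxE scalerA mulrA.
Qed.

Lemma omul1o (k : nat) : omul (o1 R) (oe R k) = oe R k.
Proof. by rewrite /o1 /oe omul_delta /omul_basis /= inord_val. Qed.

Lemma toCK : cancel (@toC R) (@ofC R).
Proof.
move=> u; apply/rowP => j; rewrite /ofC /toC !mxE !inordK //=.
case: j => [[|[|[|[|[|[|n]]]]]] jP] //=; congr (u 0 _); apply: val_inj;
  by rewrite /= inordK.
Qed.

Lemma ofCK : cancel (@ofC R) (@toC R).
Proof.
move=> z; apply/colP => j; rewrite /ofC /toC !mxE !inordK //=.
have e w : Complex (complex.Re w) (complex.Im w) = w :> R[i] by case: w.
case: j => [[|[|[|n]]] jP] //=; rewrite e; congr (z _ _); apply: val_inj;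
  by rewrite /= inordK.
Qed.

Lemma oembE (u : 'rV[R]_6) (j : 'I_8) :
  oemb u 0 j = if (0 < j < 7)%N then u 0 (inord j.-1) else 0.
Proof.
rewrite /oemb mxE; case: splitP => k jk; last first.
  by rewrite mxE jk ord1.
rewrite mxE; case: splitP => l kl; first by rewrite mxE jk kl ord1.
rewrite jk kl (_ : (0 < 1 + l < 7)%N); last exact: (ltn_ord l).
by rewrite add1n /= inord_val.
Qed.

Lemma orestrE (a : 'rV[R]_8) (j : 'I_6) : orestr a 0 j = a 0 (inord j.+1).
Proof.
rewrite /orestr !mxE; congr (a 0 _); apply: val_inj; rewrite /= inordK //.
by rewrite (ltn_trans (_ : _ < 7)%N) // ltnS ltn_ord.
Qed.

Lemma oeE (k : nat) (j : 'I_8) : oe R k 0 j = ((j : nat) == ((k + 6) %% 7).+1)%:R.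
Proof.
rewrite /oe mxE eqxx /= -val_eqE /= inordK //.
by rewrite ltnS ltn_mod. Qed.

Lemma oemb_ofC (z : 'cV[R[i]]_3) :
  oemb (ofC z) = \sum_(k < 3) omul (complex.Re (z k 0) *: o1 R
                                    + complex.Im (z k 0) *: oe R 7)
                                   (oe R (nth 0 [:: 1; 2; 4] k)%N).
Proof.
have [e71 e72 e74] := omul_e7 R.
rewrite !big_ord_recl big_ord0 addr0 /= !omulDl !omulZl !omul1o e71 e72 e74.
apply/rowP => j; rewrite oembE.
have aE (a b : 'rV[R]_8) : (a + b) 0 j = a 0 j + b 0 j by rewrite mxE.
have sE (a : R) (b : 'rV[R]_8) : (a *: b) 0 j = a * b 0 j by rewrite mxE.
rewrite !aE !sE !oeE {aE sE}.
have i1 : lift ord0 ord0 = inord 1 :> 'I_3 by apply: val_inj; rewrite /= inordK.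
have i2 : lift ord0 (lift ord0 ord0) = inord 2 :> 'I_3.
  by apply: val_inj; rewrite /= inordK.
have i0 : ord0 = inord 0 :> 'I_3 by apply: val_inj; rewrite /= inordK.
rewrite i2 i1 i0 /ofC; case: j => [[|[|[|[|[|[|[|[|n]]]]]]]] jP] //=;
  rewrite ?mxE ?inordK //=; ring.
Qed.

Lemma retr_val (p : S5 R) : retr (val p) = p.
Proof. by rewrite /retr (eqP (valP p)) sqrtr1 invr1 scale1r valKd. Qed.

Lemma dot_ofC (z w : 'cV[R[i]]_3) :
  dot (ofC z) (ofC w) = complex.Re (\sum_(k < 3) z k 0 * (w k 0)^*%C).
Proof.
have i1 : lift ord0 ord0 = inord 1 :> 'I_3 by apply: val_inj; rewrite /= inordK.
have i2 : lift ord0 (lift ord0 ord0) = inord 2 :> 'I_3.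
  by apply: val_inj; rewrite /= inordK.
have i0 : ord0 = inord 0 :> 'I_3 by apply: val_inj; rewrite /= inordK.
rewrite /dot mxE !big_ord_recl !big_ord0 !addr0 !mxE /= i2 i1 i0.
case: (z _ 0) => a b; case: (z _ 0) => c d; case: (z _ 0) => e f.
case: (w _ 0) => a' b'; case: (w _ 0) => c' d'; case: (w _ 0) => e' f' /=.
ring.
Qed.

Lemma dot_act (s : 'M[R[i]]_3) u v : s \is unitarymx ->
  dot (act s u) (act s v) = dot u v.
Proof.
move=> sU; rewrite -[u in RHS]toCK -[v in RHS]toCK /act !dot_ofC; congr complex.Re.
have e (z w : 'cV[R[i]]_3) :
    \sum_(k < 3) z k 0 * (w k 0)^*%C = (z^T *m map_mx conjc w) 0 0.
  by rewrite mxE; apply: eq_bigr => k _; rewrite !mxE.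
rewrite !e map_mxM trmx_mul mulmxA -(mulmxA (toC u)^T).
suff -> : s^T *m map_mx conjc s = 1%:M by rewrite mulmx1.
have /mulmx1C h : s *m (map_mx conjc s)^T = 1%:M.
  by rewrite -[RHS](unitarymxP sU); congr (_ *m _); apply/matrixP => i j; rewrite !mxE.
by apply: trmx_inj; rewrite trmx_mul trmxK h trmx1.
Qed.

Lemma retr_act (s : 'M[R[i]]_3) (p : S5 R) : SU3 s ->
  val (retr (act (invmx s) (val p))) = act (invmx s) (val p).
Proof.
move=> [sU _]; have h : dot (act (invmx s) (val p)) (act (invmx s) (val p)) == 1.
  rewrite -(dot_act _ _ sU) /act ofCK mulmxA mulmxV ?unitarymx_unit //.
  by rewrite mul1mx toCK; exact: (valP p).
by rewrite /retr (eqP h) sqrtr1 invr1 scale1r val_insubd h.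
Qed.

Lemma tproj_frame (p : S5 R) (b : 'M[R]_(5, 6)) :
  b *m b^T = 1%:M -> b *m (val p)^T = 0 ->
  \sum_(i < 6) (tproj p (delta_mx 0 i))^T *m tproj p (delta_mx 0 i) =
  \sum_(k < 5) (row k b)^T *m row k b.
Proof.
move=> bb bp.
have pp : val p *m (val p)^T = 1%:M.
  apply/matrixP => i j; rewrite !ord1 [RHS]mxE eqxx; exact: (eqP (valP p)).
have sumE m (A : 'M[R]_(m, 6)) : \sum_k (row k A)^T *m row k A = A^T *m A.
  apply/matrixP => i j; rewrite summxE mxE; apply: eq_bigr => k _.
  by rewrite mxE big_ord1 !mxE.
rewrite sumE; pose P : 'M[R]_6 := 1%:M - (val p)^T *m val p.
have tP i : tproj p (delta_mx 0 i) = row i P.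
  rewrite /tproj /P rowE mulmxBr mulmx1 mulmxA; congr (_ - _).
  by rewrite [delta_mx 0 i *m _]mx11_scalar mul_scalar_mx.
under eq_bigr do rewrite tP.
have PT : P^T = P by rewrite [LHS]raddfB /= trmx1 trmx_mul trmxK.
rewrite sumE PT /P mulmxBl mul1mx mulmxBr mulmx1.
rewrite -mulmxA [val p *m _]mulmxA pp mul1mx subrr subr0.
pose M := col_mx b (val p).
have MM : M *m M^T = 1%:M.
  rewrite /M tr_col_mx mul_col_row bb bp pp.
  have -> : val p *m b^T = 0 by apply: trmx_inj; rewrite trmx_mul trmxK bp trmx0.
  by rewrite -scalar_mx_block.
have /eqP := mulmx1C MM; rewrite /M tr_col_mx mul_row_col => /eqP.
by move/(canRL (addrK _)).
Qed.

Lemma dot_nu (a : 'rV[R]_8) : dot a (nu R) = - a 0 (inord 7).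
Proof.
rewrite /dot /nu linearN mulmxN mxE; congr (- _).
rewrite mxE (bigD1 (inord 7)) //= big1 ?addr0.
  by rewrite mxE oeE inordK // eqxx mulr1.
move=> i; rewrite -val_eqE /= inordK // => /negPf ni.
by rewrite mxE oeE ni mulr0.
Qed.

Lemma Jmap_nu (p : S5 R) (u : 'rV[R]_6) : dot (Jmap p u) (nu R) = eta_form p u.
Proof.
have jo (a : 'rV[R]_8) : (oIm a) 0 (inord 7) = a 0 (inord 7).
  by rewrite /oIm /o1 !mxE eqxx -val_eqE /= inordK // mulr0 subr0.
rewrite dot_nu /Jmap jo /omul summxE.
under eq_bigr => i _.
  rewrite summxE; under eq_bigr => j _ do rewrite mxE !oembE.
  over.
have oE k : oe R k 0 (inord 7) = (6 == (k + 6) %% 7)%N%:R by rewrite oeE inordK.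
have oNE k : (- oe R k) 0 (inord 7) = - (6 == (k + 6) %% 7)%N%:R.
  by rewrite mxE oE.
have o1E : (- o1 R) 0 (inord 7) = 0.
  by rewrite /o1 !mxE eqxx -val_eqE /= inordK // oppr0.
rewrite !big_ord_recl !big_ord0 /omul_basis /= !(mul0r, mulr0, add0r, addr0).
rewrite !(oE, oNE, o1E) /= !(mul0r, mulr0, mulrN, oppr0, add0r, addr0, mulr1).
rewrite /eta_form /dot /muli /ofC /toC mxE !big_ord_recl big_ord0 !mxE /= !inordK //=.
have v (w : 'rV[R]_6) (i : 'I_6) : w 0 i = w 0 (inord i) by rewrite inord_val.
rewrite ![sval p 0 (lift _ _)]v [sval p 0 ord0]v /= /bump /=.
rewrite !(add0n, addn0, add1n) /=.
ring.
Qed.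

Lemma Jmap_decomp (p : S5 R) (u : 'rV[R]_6) :
  Jmap p u = oemb (psihat p u) + eta_form p u *: nu R.
Proof.
rewrite /psihat Jmap_nu; apply/rowP => j; rewrite [RHS]mxE oembE.
have n j' : (nu R) 0 j' = - ((j' : nat) == 7)%N%:R by rewrite mxE oeE.
rewrite [X in _ = _ + X]mxE n; case: ifP => [/andP[j0 j7]|].
  have j6 : (j.-1 < 6)%N by rewrite -ltnS prednK.
  rewrite orestrE (inordK j6) prednK // inord_val [X in _ = X + _]mxE.
  by rewrite [X in _ = _ + X + _]mxE [X in _ = _ - X + _]mxE n addrNK.
case: (posnP j) => [j0 _|j0 /negbT /=].
  have -> : j = 0 by apply: val_inj.
  by rewrite /Jmap /oIm /o1 !mxE eqxx /= mulr1 subrr oppr0 mulr0 addr0.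
rewrite -leqNgt => j7; have j7' : j = inord 7 :> 'I_8.
  apply: val_inj; rewrite /= inordK //; apply/eqP; rewrite eqn_leq j7 andbT.
  by rewrite -ltnS ltn_ord.
by rewrite add0r j7' inordK // eqxx mulrN mulr1 -Jmap_nu dot_nu opprK.
Qed.

End Validation.

(* Main.v *)
(* Write nabla = nabla^g + A.  Uniqueness of the Levi-Civita connection gives
   nabla^g_X Y = D_X Y + <X, Y> p (Gauss), whose curvature is that of the unit
   sphere.  When <A(X, Y), Z> is totally skew-symmetric, all terms of the Ricci
   tensor which involve a derivative of A are antisymmetric in Y, Z, so that
     Sym Ric (Y, Z) = 4 <Y, Z> - sum_i <A(e_i, Y), A(e_i, Z)>.
   For the given family, A(X, Y) = eta(X) F Y - eta(Y) F X + <F X, Y> xi, where F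
   is skew and F^2 = -(r^2 + |q|^2) on the contact hyperplane, which gives the
   formula.

   For the second part no classification is needed: the element of SU(3) which
   fixes p and is -1 on its complex orthogonal forces the 3-form <A(X, Y), Z> to
   vanish on the contact hyperplane, i.e. to be eta /\ b for a 2-form b.  Then
   sum_i |A(e_i, y)|^2 is |b|^2 for y = xi and 2 |b(y, .)|^2 for y a horizontal
   unit vector; if it is a constant mu, then |b|^2 = mu and 2 |b|^2 = 4 mu. *)

From HB Require Import structures.
Require Import Defs.
From mathcomp Require Import all_boot all_order all_algebra spectral complex.
From mathcomp Require Import all_classical all_reals all_analysis.
From mathcomp Require Import ring lra.

Set Implicit Arguments.
Unset Strict Implicit.
Unset Printing Implicit Defensive.

Import Order.TTheory GRing.Theory Num.Theory.
Import numFieldNormedType.Exports.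

Local Open Scope classical_set_scope.
Local Open Scope ring_scope.

(** * Differentiability and smoothness *)

Section Differentiability.
Context {R : realType}.
Implicit Types V W : normedModType R.

(** Derivatives along the sphere are taken through [retr], so each computation is first moved to a
    smooth extension on an open set of R^6. There, the commutation of [D X] and [D Y] up to the
    bracket rests on the symmetry of second derivatives. A connection takes global fields as
    arguments, so a locally defined orthonormal frame cannot be fed to it. The six projected
    coordinate fields E_i replace such a frame: they form a Parseval frame of every tangent space,
    which gives the traces, and every vector field is a combination of them with smooth global
    coefficients, which gives tensoriality without cut-off functions. The derivatives of A leave Sym
    Ric for two reasons. The term with D_X (A(Y, Z)) is antisymmetric because A is. In the term with
    D_Y (A(X, Z)) the derivative moves onto X, because <A(X, Z), X> vanishes identically. The
    constant 4 is 5 - 1, the trace of the tangent projection minus one Parseval sum. The combination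
    r^2 + |q|^2 appears because psi, psihat and their composite act on the contact hyperplane like
    the three imaginary quaternion units, so that their coefficients add as squares. *)

Lemma near_eq_differentiable V W (f f' : V -> W) x :
  {near x, f =1 f'} -> differentiable f x -> differentiable f' x.
Proof.
move=> ff' fd; have fx : f x = f' x by exact: nbhs_singleton ff'.
have e : f' \o shift x = cst (f' x) + 'd f x +o_ 0 id.
  have /eqaddoP h := diff_locally fd.
  apply/eqaddoP => eps eps0; have := h _ eps0.
  have : \forall y \near (0 : V), f (y + x) = f' (y + x).
    by move: ff'; rewrite (near_shift 0) subr0.
  apply: filterS2 => y e /=; rewrite !fctE /= -fx -e; exact.
(* The expansion of f at x is also one of f', and its linear part is continuous, so [diff_unique]
   identifies it with the differential of f'. *)
have c := diff_continuous fd.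
by apply: (diff_locallyP x f').2; rewrite (diff_unique c e).
Qed.

Lemma bilinear_scaler W :
  bilinear_for (GRing.Scale.Law.clone _ _ *:%R _) (GRing.Scale.Law.clone _ _ *:%R _)
    (fun (a : R^o) (w : W) => a *: w).
Proof.
split=> [w|a] k x y /=; first by rewrite scalerDl scalerA.
by rewrite scalerDr !scalerA mulrC.
Qed.

(** Scalar multiplication is packed as a continuous bilinear map and composed with the pairing of f
    and F; the two terms are the partial differentials of that bilinear map. *)
Lemma is_diff_scale V W (f : V -> R^o) (F : V -> W) x :
  differentiable f x -> differentiable F x ->
  is_diff x (fun y => f y *: F y) (fun v => f x *: 'd F x v + 'd f x v *: F x).
Proof.
move=> fd Fd.
pose sM := bilinear_isBilinear.Build R R^o W W _ _ _ (@bilinear_scaler W).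
pose B : {bilinear R^o -> W -> W} := HB.pack (fun (a : R^o) (w : W) => a *: w) sM.
have Bc : continuous (fun q : R^o * W => B q.1 q.2) by exact: scale_continuous.
have Bd p : is_diff p (fun q : R^o * W => B q.1 q.2)
   (fun q => B p.1 q.2 + B q.1 p.2).
  by apply: DiffDef; [exact: differentiable_bilin | exact: diff_bilin].
have pd := is_diff_pair (differentiableP fd) (differentiableP Fd).
exact: (is_diff_comp pd (Bd _)).
Qed.

Lemma differentiable_scale V W (f : V -> R^o) (F : V -> W) x :
  differentiable f x -> differentiable F x ->
  differentiable (fun y => f y *: F y) x.
Proof. by move=> fd Fd; have [] := is_diff_scale fd Fd. Qed.

Lemma derive_scale V W (f : V -> R^o) (F : V -> W) x v :
  differentiable f x -> differentiable F x ->
  'D_v (fun y => f y *: F y) x = ('D_v f x : R) *: F x + f x *: 'D_v F x.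
Proof.
move=> fd Fd; have [d e] := is_diff_scale fd Fd.
have fFd := differentiable_scale fd Fd.
by rewrite (deriveE v fFd) (deriveE v fd) (deriveE v Fd) e addrC.
Qed.

Lemma derive_comp V W (W' : normedModType R) (f : V -> W) (h : W -> W') x v :
  differentiable f x -> differentiable h (f x) ->
  'D_v (h \o f) x = 'D_('D_v f x) h (f x).
Proof.
move=> fd hd; have hfd : differentiable (h \o f) x by exact: differentiable_comp.
by rewrite (deriveE v hfd) (deriveE v fd) (deriveE _ hd) diff_comp.
Qed.

End Differentiability.

Section LinearMaps.
Context {R : realType} {n : nat} {W : normedModType R}.

Lemma linear_rV_sum (L : 'rV[R]_n -> W) : linear L ->
  forall v, L v = \sum_j v 0 j *: L (delta_mx 0 j).
Proof.
move=> Ll v; pose lM := GRing.isLinear.Build _ _ _ _ _ Ll.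
pose LL : {linear _ -> _} := HB.pack L lM.
transitivity (LL (\sum_j v 0 j *: delta_mx 0 j)); first by rewrite -row_sum_delta.
by rewrite linear_sum; apply: eq_bigr => j _; rewrite linearZ.
Qed.

(** In finite dimension L is a sum of coordinates times constant vectors, hence differentiable and
    so continuous; continuity is what makes L its own differential. *)
Lemma linear_rV_is_diff (L : 'rV[R]_n -> W) x : linear L -> is_diff x L L.
Proof.
move=> Ll; pose lM := GRing.isLinear.Build _ _ _ _ _ Ll.
pose LL : {linear _ -> _} := HB.pack L lM.
have Ld y : differentiable L y.
  have -> : L = fun v => \sum_j v 0 j *: L (delta_mx 0 j).
    by apply/funext => v; exact: linear_rV_sum.
  have -> : (fun v : 'rV[R]_n => \sum_j v 0 j *: L (delta_mx 0 j)) =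
      \sum_j (fun v : 'rV[R]_n => v 0 j *: L (delta_mx 0 j)).
    by apply/funext => v; rewrite fct_sumE.
  apply: differentiable_sum => j; apply: differentiableZl.
  exact: differentiable_coord.
have Lc : continuous LL by move=> y; exact: differentiable_continuous (Ld y).
by apply: DiffDef => //; exact: (diff_lin _ Lc).
Qed.

End LinearMaps.

Section Smoothness.
Context {R : realType}.
Implicit Types V W : normedModType R.

(** Openness of U lets an equality on U pass to derivatives at the points of U. The inductions below
    rely on this: a rule such as the product rule identifies derivatives on U only. *)
Lemma Ck_on_ext V W k (U : set V) (f f' : V -> W) : open U ->
  (forall x, U x -> f x = f' x) -> Ck_on k U f -> Ck_on k U f'.
Proof.
move=> Uo; have near_eq (f1 f2 : V -> W) : (forall x, U x -> f1 x = f2 x) ->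
    forall x, U x -> {near x, f1 =1 f2}.
  move=> e x Ux; apply: filterS (open_nbhs_nbhs (conj Uo Ux)) => y; exact: e.
elim: k f f' => [|k IH] f f' e /=.
  move=> fc x Ux; suff: f' @ x --> f' x by [].
  rewrite -e //; apply: cvg_trans (fc x Ux).
  exact: near_eq_cvg (near_eq _ _ e x Ux).
move=> [fd fk]; split=> [x Ux|v].
  exact: near_eq_differentiable (near_eq _ _ e x Ux) (fd x Ux).
apply: IH (fk v) => x Ux; apply: near_eq_derive; exact: near_eq.
Qed.

Lemma Ck_on_subset V W k (U U' : set V) (f : V -> W) :
  U' `<=` U -> Ck_on k U f -> Ck_on k U' f.
Proof.
move=> UU; elim: k f => [|k IH] f /=; first by move=> h x /UU; exact: h.
by move=> [fd fk]; split=> [x /UU /fd//|v]; exact: IH.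
Qed.

Lemma Ck_on_pred V W k (U : set V) (f : V -> W) : Ck_on k.+1 U f -> Ck_on k U f.
Proof.
elim: k f => [|k IH] f [fd fk]; first by move=> x /fd /differentiable_continuous.
by split=> // v; exact: IH.
Qed.

Lemma Ck_on_cst V W k (U : set V) (w : W) : Ck_on k U (fun _ : V => w).
Proof.
elim: k w => [|k IH] w /=; first by move=> x _; exact: cst_continuous.
split=> [x _|v]; first exact: differentiable_cst.
by have -> : 'D_v (fun _ : V => w) = fun=> 0
  by apply/funext => x; exact: derive_cst.
Qed.

Lemma Ck_on_add V W k (U : set V) (f f' : V -> W) : open U ->
  Ck_on k U f -> Ck_on k U f' -> Ck_on k U (fun x => f x + f' x).
Proof.
move=> Uo; elim: k f f' => [|k IH] f f' /=.
  by move=> fc fc' x Ux; apply: continuousD; [exact: fc|exact: fc'].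
move=> [fd fk] [fd' fk']; split=> [x Ux|v].
  by apply: differentiableD; [exact: fd|exact: fd'].
apply: (Ck_on_ext Uo _ (IH _ _ (fk v) (fk' v))) => x Ux.
by rewrite -deriveD //; apply: diff_derivable; [exact: fd|exact: fd'].
Qed.

Lemma Ck_on_scale V W k (U : set V) (f : V -> R^o) (F : V -> W) : open U ->
  Ck_on k U f -> Ck_on k U F -> Ck_on k U (fun x => f x *: F x).
Proof.
move=> Uo; elim: k f F => [|k IH] f F fk Fk.
  by move=> x Ux; apply: continuousZ; [exact: fk|exact: Fk].
have [fd fD] := fk; have [Fd FD] := Fk; split=> [x Ux|v].
  by apply: differentiable_scale; [exact: fd|exact: Fd].
apply: (Ck_on_ext Uo _ (Ck_on_add Uo (IH _ _ (fD v) (Ck_on_pred Fk))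
  (IH _ _ (Ck_on_pred fk) (FD v)))) => x Ux.
by rewrite derive_scale //; [exact: fd|exact: Fd].
Qed.

Lemma Ck_on_lin_comp V W n k (U : set V) (L : 'rV[R]_n -> W) (f : V -> 'rV[R]_n) :
  linear L -> open U -> Ck_on k U f -> Ck_on k U (L \o f).
Proof.
move=> Ll Uo; elim: k f => [|k IH] f /=.
  move=> fc x Ux; apply: continuous_comp; first exact: fc.
  by apply: differentiable_continuous; have [] := linear_rV_is_diff (f x) Ll.
move=> [fd fk]; split=> [x Ux|v].
  by apply: differentiable_comp; [exact: fd|have [] := linear_rV_is_diff (f x) Ll].
apply: (Ck_on_ext Uo _ (IH _ (fk v))) => x Ux.
have [Ld Le] := linear_rV_is_diff (f x) Ll.
by rewrite (derive_comp v (fd x Ux) Ld) (deriveE _ Ld) Le.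
Qed.

Lemma Ck_on_comp_lin W n m k (U : set 'rV[R]_m) (L : 'rV[R]_n -> 'rV[R]_m)
    (f : 'rV[R]_m -> W) :
  linear L -> open U -> Ck_on k U f -> Ck_on k (L @^-1` U) (f \o L).
Proof.
move=> Ll Uo; have Ld x : differentiable L x by have [] := linear_rV_is_diff x Ll.
have Lo : open (L @^-1` U).
  by apply: open_comp => // x _; exact: differentiable_continuous.
elim: k f => [|k IH] f /=.
  move=> fc x Ux; apply: continuous_comp; last exact: fc.
  exact: differentiable_continuous.
move=> [fd fk]; split=> [x Ux|v].
  by apply: differentiable_comp => //; exact: fd.
apply: (Ck_on_ext Lo _ (IH _ (fk (L v)))) => x Ux /=.
have [_ Le] := linear_rV_is_diff x Ll.
by rewrite (derive_comp v (Ld x) (fd _ Ux)) (deriveE v (Ld x)) Le.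
Qed.

Implicit Types (X Y Z : field R) (p : S5 R).

Lemma smooth_cst W (w : W) : smooth (fun _ : S5 R => w).
Proof.
exists setT, (fun=> w); split => //; first exact: openT.
by move=> k; exact: Ck_on_cst.
Qed.

Lemma smooth_val : smooth (fun p : S5 R => val p).
Proof.
exists setT, id; split => //; first exact: openT.
elim=> [|k IH] /=; first by move=> x _; exact: cvg_id.
split=> // v.
have -> : 'D_v (id : 'rV[R]_6 -> 'rV[R]_6) = fun=> v
  by apply/funext => x; exact: derive_id.
exact: Ck_on_cst.
Qed.

Lemma smooth_add W (f f' : S5 R -> W) :
  smooth f -> smooth f' -> smooth (fun p => f p + f' p).
Proof.
move=> [U [F [Uo Up Fk Ff]]] [U' [F' [Uo' Up' Fk' Ff']]].
have Io : open (U `&` U') by exact: openI.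
exists (U `&` U'), (fun x => F x + F' x); split => //.
  by move=> k; apply: Ck_on_add => //; [apply: Ck_on_subset (Fk k)|
    apply: Ck_on_subset (Fk' k)] => x [].
by move=> p; rewrite Ff Ff'.
Qed.

Lemma smooth_scale W (f : S5 R -> R^o) (F : S5 R -> W) :
  smooth f -> smooth F -> smooth (fun p => f p *: F p).
Proof.
move=> [U [f1 [Uo Up Fk Ff]]] [U' [F1 [Uo' Up' Fk' Ff']]].
have Io : open (U `&` U') by exact: openI.
exists (U `&` U'), (fun x => f1 x *: F1 x); split => //.
  by move=> k; apply: Ck_on_scale => //; [apply: Ck_on_subset (Fk k)|
    apply: Ck_on_subset (Fk' k)] => x [].
by move=> p; rewrite Ff Ff'.
Qed.

Lemma smooth_lin W n (L : 'rV[R]_n -> W) (f : S5 R -> 'rV[R]_n) :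
  linear L -> smooth f -> smooth (fun p => L (f p)).
Proof.
move=> Ll [U [F [Uo Up Fk Ff]]]; exists U, (L \o F); split => //.
  by move=> k; exact: Ck_on_lin_comp.
by move=> p /=; rewrite Ff.
Qed.

Lemma smooth_sum W (I : Type) (r : seq I) (P : pred I) (f : I -> S5 R -> W) :
  (forall i, smooth (f i)) -> smooth (fun p => \sum_(i <- r | P i) f i p).
Proof.
move=> fs; elim: r => [|i r IH].
  under [X in smooth X]eq_fun do rewrite big_nil.
  exact: smooth_cst.
under [X in smooth X]eq_fun do rewrite big_cons.
by case: (P i) => //; exact: smooth_add.
Qed.

Lemma smooth_opp W (f : S5 R -> W) : smooth f -> smooth (fun p => - f p).
Proof.
move=> fs; under [X in smooth X]eq_fun do rewrite -scaleN1r.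
by apply: smooth_scale fs; exact: smooth_cst.
Qed.

Lemma smooth_sub W (f f' : S5 R -> W) :
  smooth f -> smooth f' -> smooth (fun p => f p - f' p).
Proof. by move=> fs fs'; apply: smooth_add => //; exact: smooth_opp. Qed.

Lemma smooth_coord n (X : S5 R -> 'rV[R]_n) j :
  smooth X -> smooth (fun p => X p 0 j : R^o).
Proof.
by apply: (@smooth_lin R^o n (fun v => v 0 j)) => k u v; rewrite !mxE.
Qed.

Lemma dotE n (u v : 'rV[R]_n) : dot u v = \sum_j u 0 j * v 0 j.
Proof. by rewrite /dot mxE; apply: eq_bigr => j _; rewrite mxE. Qed.

Lemma smooth_dot X Y : smooth X -> smooth Y -> smooth (fun p => dot (X p) (Y p) : R^o).
Proof.
move=> Xs Ys; under [X in smooth X]eq_fun do rewrite dotE.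
by apply: smooth_sum => j; apply: (@smooth_scale R^o); exact: smooth_coord.
Qed.

Lemma smooth_bilin (B : 'rV[R]_6 -> 'rV[R]_6 -> 'rV[R]_6) X Y :
  (forall u, linear (B u)) -> (forall v, linear (B^~ v)) ->
  smooth X -> smooth Y -> smooth (fun p => B (X p) (Y p)).
Proof.
move=> B1 B2 Xs Ys.
under [X in smooth X]eq_fun => p do rewrite (linear_rV_sum (B2 (Y p))).
apply: smooth_sum => i; apply: smooth_scale; first exact: smooth_coord.
exact: smooth_lin.
Qed.

End Smoothness.

(** * Symmetry of second derivatives *)

Section Schwarz.
Context {R : realType} {V : normedModType R}.
Implicit Types (F : V -> R^o) (x u v p : V).

Let dist_lt_add (a b c : R^o) (e : R) : `|a - b| < e -> `|c - b| < e -> `|a - c| < e + e.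
Proof.
move=> ab cb; rewrite -(subrKA b) (le_lt_trans (ler_normD _ _)) //.
by rewrite ltrD // distrC.
Qed.

Let difference_swap (h a b c d A B : R) : h != 0 ->
  a - b - (c - d) = h * (h * A) -> a - c - (b - d) = h * (h * B) -> A = B.
Proof.
move=> h0 eA eB; do 2!apply: (mulfI h0).
by rewrite -eA -eB; ring.
Qed.

Lemma MVT_line F x u (h : R) : 0 < h ->
  (forall t, 0 <= t <= h -> differentiable F (x + t *: u)) ->
  exists2 c, 0 <= c <= h &
    F (x + h *: u) - F x = h * 'D_u F (x + c *: u) :> R.
Proof.
move=> h0 Fd; pose l (t : R) := x + t *: u.
have ld t : is_diff (t : R^o) (l : R^o -> V) (fun s => s *: u).
  have sd : is_diff (t : R^o) (fun s : R^o => s *: u) (fun s => s *: u).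
    exact: is_diff_scalel.
  have [d e] := is_diffD (is_diff_cst x (t : R^o)) sd.
  by apply: DiffDef; [exact: d|exact: etrans e (add0r _)].
have d t : 0 <= t <= h -> is_derive (t : R^o) 1 (F \o l) ('D_u F (l t)).
  move=> th; have [ldt lde] := ld t.
  have Fl : differentiable F (l t) by exact: Fd.
  have Fld : differentiable (F \o l) (t : R^o) by exact: differentiable_comp.
  apply: DeriveDef; first exact: diff_derivable.
  by rewrite (derive_comp _ ldt Fl) (deriveE _ ldt) lde scale1r.
have [||c] := @MVT R (F \o l) (fun t => 'D_u F (l t)) 0 h h0.
- by move=> t; rewrite in_itv /= => /andP[t0 th]; apply: d; rewrite !ltW.
- apply: derivable_within_continuous => t; rewrite in_itv /= => th.
  by have [] := d t th.
rewrite in_itv /= => /andP[c0 ch]; rewrite /l /= scale0r addr0 subr0 => e.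
by exists c; [rewrite !ltW|rewrite e mulrC].
Qed.

(** The mean value theorem is applied twice: along u to the increment of F in the direction
    [h *: v], then along v to ['D_u F]. *)
Lemma second_difference F x u v (h : R) : 0 < h ->
  (forall s t, 0 <= s <= h -> 0 <= t <= h ->
    differentiable F (x + s *: u + t *: v) /\
    differentiable ('D_u F) (x + s *: u + t *: v)) ->
  exists s t, [/\ 0 <= s <= h, 0 <= t <= h &
    F (x + h *: u + h *: v) - F (x + h *: u) - (F (x + h *: v) - F x) =
    h * (h * 'D_v ('D_u F) (x + s *: u + t *: v)) :> R].
Proof.
move=> h0 Fd; have hh : 0 <= h <= h by rewrite lexx ltW.
have oh : 0 <= (0 : R) <= h by rewrite lexx ltW.
pose k y := F (y + h *: v) - F y.
have ad y : is_diff y (fun z => z + h *: v) id.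
  have [d e] := is_diffD (is_diff_id y) (is_diff_cst (h *: v) y).
  by apply: DiffDef; [exact: d|exact: etrans e (addr0 _)].
have kd s : 0 <= s <= h -> differentiable k (x + s *: u) /\
    'D_u k (x + s *: u) = 'D_u F (x + s *: u + h *: v) - 'D_u F (x + s *: u).
  move=> sh; have [d1 _] := Fd _ _ sh hh; have [] := Fd _ _ sh oh.
  rewrite scale0r addr0 => d0 _; have [ady ade] := ad (x + s *: u).
  have d2 : differentiable (F \o (fun z => z + h *: v)) (x + s *: u).
    exact: differentiable_comp.
  split; first exact: differentiableB.
  rewrite /k deriveB; [|exact: diff_derivable|exact: diff_derivable].
  by rewrite (derive_comp _ ady d1) (deriveE _ ady) ade.
have [s sh es] := MVT_line h0 (fun s sh => (kd s sh).1).
have [_ ks] := kd s sh.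
have [|t th et] := @MVT_line ('D_u F) (x + s *: u) v h h0.
  by move=> t th; have [] := Fd _ _ sh th.
exists s, t; split=> //; by rewrite -et -ks -es.
Qed.

Lemma near_parallelogram (P : set V) x u v : (\forall y \near x, P y) ->
  exists2 h : R, 0 < h & forall s t, 0 <= s <= h -> 0 <= t <= h ->
    P (x + s *: u + t *: v).
Proof.
move=> /nbhs_ballP[e /= e0 eP]; pose m := `|u| + `|v| + 1.
have m0 : 0 < m by rewrite /m ltr_wpDl // addr_ge0.
(* The summand 1 in m keeps m positive when u and v vanish; the factor 1/2 keeps the closed
   parallelogram inside the open ball. *)
exists (e / 2 / m); first by rewrite !divr_gt0.
move=> s t /andP[s0 sh] /andP[t0 th]; apply: eP; rewrite -ball_normE /ball_ /=.
rewrite -[x + _ + _]addrA opprD addrA subrr add0r normrN.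
rewrite (le_lt_trans (ler_normD _ _)) // !normrZ !ger0_norm //.
have : s * `|u| + t * `|v| <= e / 2 / m * m.
  rewrite (le_trans (lerD (ler_wpM2r _ sh) (ler_wpM2r _ th))) //.
  by rewrite -mulrDr ler_wpM2l ?divr_ge0 ?ltW // /m ltrDl.
rewrite divfK ?gt_eqF // => h; rewrite (le_lt_trans h) //.
by rewrite ltr_pdivrMr // ltr_pMr // ltrDl.
Qed.

(** The mean value points found for the two orders of differentiation differ, so the values of G and
    H can be compared only at two distinct points close to x; continuity closes the gap. *)
Lemma eq_of_near_eq (G H : V -> R^o) x :
  {for x, continuous G} -> {for x, continuous H} ->
  (forall P : set V, (\forall y \near x, P y) ->
    exists y z, [/\ P y, P z & G y = H z]) -> G x = H x.
Proof.
move=> /cvgrPdist_lt Gc /cvgrPdist_lt Hc GH; apply/eqP; rewrite -subr_eq0 -normr_eq0.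
apply/negPn/negP => n0; have e0 : 0 < `|G x - H x| / 2.
  by rewrite divr_gt0 // lt0r n0 normr_ge0.
have [y [z [[yG _] [_ zH] e]]] := GH _ (filterI (Gc _ e0) (Hc _ e0)).
rewrite -e in zH; have := dist_lt_add yG zH.
by rewrite -splitr ltxx.
Qed.

(** The second difference of F over a small parallelogram is symmetric in u and v, so evaluating it
    in the two orders equates the mixed derivatives at two points near x. *)
Lemma derive_swap_scalar (U : set V) F x u v : open U -> U x ->
  (forall y, U y -> differentiable F y) ->
  (forall y, U y -> differentiable ('D_u F) y) ->
  (forall y, U y -> differentiable ('D_v F) y) ->
  {for x, continuous ('D_v ('D_u F))} -> {for x, continuous ('D_u ('D_v F))} ->
  'D_v ('D_u F) x = 'D_u ('D_v F) x.
Proof.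
move=> Uo Ux Fd ud vd uvc vuc; apply: (eq_of_near_eq uvc vuc) => P xP.
have Un : \forall y \near x, U y by exact: open_nbhs_nbhs.
have [h h0 hP] := near_parallelogram u v (filterI Un xP).
have [s t sh th|s [t [sh th est]]] := @second_difference F x u v h h0.
  by have [Uy _] := hP s t sh th; split; [exact: Fd|exact: ud].
have [s' t' sh' th'|s' [t' [sh' th' est']]] := @second_difference F x v u h h0.
  have [Uy _] := hP t' s' th' sh'; rewrite [x + _ + _]addrAC.
  by split; [exact: Fd|exact: vd].
exists (x + s *: u + t *: v), (x + t' *: u + s' *: v).
split; [by have [] := hP s t sh th|by have [] := hP t' s' th' sh'|].
move: est est'; rewrite [x + h *: v + _]addrAC [x + s' *: v + _]addrAC.
move: ('D_v ('D_u F) _) ('D_u ('D_v F) _) => A B.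
move: (F _) (F _) (F _) (F _) => a b c d; apply: difference_swap.
  by rewrite lt0r_neq0.
Qed.

(** The scalar case is applied to each coordinate; order 3 supplies the continuity of the second
    derivatives through their differentiability. *)
Lemma derive_swap n (U : set V) (F : V -> 'rV[R]_n) x u v : open U -> U x ->
  Ck_on 3 U F -> 'D_v ('D_u F) x = 'D_u ('D_v F) x.
Proof.
move=> Uo Ux F3; apply/rowP => j; pose L (w : 'rV[R]_n) : R^o := w 0 j.
have Ll : linear L by move=> k a b; rewrite /L !mxE.
have LD k (G : V -> 'rV[R]_n) w : Ck_on k.+1 U G -> forall y, U y ->
    L ('D_w G y) = 'D_w (L \o G) y.
  move=> [Gd _] y Uy; have [Ld Le] := linear_rV_is_diff (G y) Ll.
  by rewrite (derive_comp w (Gd y Uy) Ld) (deriveE _ Ld) Le.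
have LDD w w' : L ('D_w' ('D_w F) x) = 'D_w' ('D_w (L \o F)) x.
  rewrite (LD 1%N) //; last by have [_] := F3; apply.
  apply: near_eq_derive; apply: filterS (open_nbhs_nbhs (conj Uo Ux)) => y Uy /=.
  exact: LD F3 _ Uy.
suff : L ('D_v ('D_u F) x) = L ('D_u ('D_v F) x) by [].
have [Fd FD] := Ck_on_lin_comp Ll Uo F3.
have [ud uD] := FD u; have [vd vD] := FD v.
apply: etrans (LDD u v) _; apply: etrans (esym (LDD v u)).
apply: (derive_swap_scalar Uo Ux Fd ud vd).
- exact: differentiable_continuous ((uD v).1 x Ux).
- exact: differentiable_continuous ((vD u).1 x Ux).
Qed.

End Schwarz.

(** * Derivatives along the sphere *)

Section Dot.
Context {R : realType} {n : nat}.
Implicit Types u v w : 'rV[R]_n.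

Lemma dotC u v : dot u v = dot v u.
Proof. by rewrite !dotE; apply: eq_bigr => j _; rewrite mulrC. Qed.

Lemma dotDl u v w : dot (u + v) w = dot u w + dot v w.
Proof. by rewrite /dot mulmxDl mxE. Qed.

Lemma dotZl k u v : dot (k *: u) v = k * dot u v.
Proof. by rewrite /dot -scalemxAl mxE. Qed.

Lemma dotNl u v : dot (- u) v = - dot u v.
Proof. by rewrite /dot mulNmx mxE. Qed.

Lemma dotBl u v w : dot (u - v) w = dot u w - dot v w.
Proof. by rewrite dotDl dotNl. Qed.

Lemma dot0l v : dot 0 v = 0.
Proof. by rewrite /dot mul0mx mxE. Qed.

Lemma dotDr u v w : dot w (u + v) = dot w u + dot w v.
Proof. by rewrite !(dotC w) dotDl. Qed.

Lemma dotZr k u v : dot v (k *: u) = k * dot v u.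
Proof. by rewrite !(dotC v) dotZl. Qed.

Lemma dotNr u v : dot v (- u) = - dot v u.
Proof. by rewrite !(dotC v) dotNl. Qed.

Lemma dotBr u v w : dot w (u - v) = dot w u - dot w v.
Proof. by rewrite !(dotC w) dotBl. Qed.

Lemma dot0r v : dot v 0 = 0.
Proof. by rewrite dotC dot0l. Qed.

Lemma dot_suml I (r : seq I) (P : pred I) (F : I -> 'rV[R]_n) v :
  dot (\sum_(i <- r | P i) F i) v = \sum_(i <- r | P i) dot (F i) v.
Proof. by apply: (big_morph (fun u => dot u v)) => [u w|]; rewrite ?dotDl ?dot0l. Qed.

Lemma dot_delta v j : dot v (delta_mx 0 j) = v 0 j.
Proof.
rewrite dotE (bigD1 j) //= mxE !eqxx mulr1 big1 ?addr0 // => i /negPf ij.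
by rewrite mxE ij andbF mulr0.
Qed.

Lemma dot_eq0 v : dot v v = 0 -> v = 0.
Proof.
rewrite dotE => /eqP; rewrite psumr_eq0; last by move=> j _; rewrite -expr2 sqr_ge0.
move=> /allP h; apply/rowP => j; rewrite mxE; apply/eqP.
by have := h j (mem_index_enum _); rewrite mulf_eq0 orbb.
Qed.

End Dot.

Section DirectionalDerivatives.
Context {R : realType}.
Implicit Types (V W : normedModType R) (p : S5 R).

Lemma dot_is_diff V n (G H : V -> 'rV[R]_n) x :
  differentiable G x -> differentiable H x ->
  is_diff x (fun y => dot (G y) (H y) : R^o)
    (fun v => dot ('d G x v) (H x) + dot (G x) ('d H x v)).
Proof.
move=> Gd Hd.
have cl (j : 'I_n) : linear (fun u : 'rV[R]_n => u 0 j : R^o).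
  by move=> k u v; rewrite !mxE.
have cd (F : V -> 'rV[R]_n) j : differentiable F x ->
    is_diff x (fun y => F y 0 j : R^o) (fun v => 'd F x v 0 j).
  move=> Fd; have Cd := linear_rV_is_diff (F x) (cl j).
  exact: (is_diff_comp (differentiableP Fd) Cd).
have pd j : is_diff x (fun y => (G y 0 j : R) *: (H y 0 j : R^o) : R^o)
    (fun v => (G x 0 j : R) *: ('d H x v 0 j : R^o) + ('d G x v 0 j : R) *: (H x 0 j : R^o)).
  have [g1 g2] := cd G j Gd; have [h1 h2] := cd H j Hd.
  have [d e] := is_diff_scale g1 h1.
  by apply: DiffDef; [exact: d|rewrite e g2 h2].
have de : (fun y => dot (G y) (H y) : R^o) =
    \sum_j (fun y => (G y 0 j : R) *: (H y 0 j : R^o) : R^o).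
  by apply/funext => y; rewrite fct_sumE dotE.
have sd : differentiable (fun y => dot (G y) (H y) : R^o) x.
  by rewrite de; apply: differentiable_sum => j; have [] := pd j.
apply: DiffDef => //; apply/funext => v.
rewrite -(deriveE v sd) de derive_sum => [|j]; last first.
  by apply: diff_derivable; have [] := pd j.
rewrite !dotE -big_split; apply: eq_bigr => j _ /=.
by have [d e] := pd j; rewrite (deriveE v d) e addrC.
Qed.

Lemma derive_dot V n (G H : V -> 'rV[R]_n) x v :
  differentiable G x -> differentiable H x ->
  'D_v (fun y => dot (G y) (H y) : R^o) x =
  dot ('D_v G x) (H x) + dot (G x) ('D_v H x) :> R.
Proof.
move=> Gd Hd; have [d e] := dot_is_diff Gd Hd.
by rewrite (deriveE v d) (deriveE v Gd) (deriveE v Hd) e.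
Qed.

Lemma dot_val p : dot (val p) (val p) = 1.
Proof. exact/eqP/(valP p). Qed.

Lemma retr_is_diff p v : dot v (val p) = 0 ->
  differentiable (fun x => val (retr x)) (val p) /\
  'D_v (fun x => val (retr x)) (val p) = v.
Proof.
move=> vp; pose h (t : R) : R := (Num.sqrt t)^-1.
pose q (x : 'rV[R]_6) : R^o := dot x x.
have idd : is_diff (val p) (id : 'rV[R]_6 -> 'rV[R]_6) id by exact: is_diff_id.
have [qd qe] := dot_is_diff (ex_diff (is_diff_def := idd)) (ex_diff (is_diff_def := idd)).
have hd : differentiable (h : R^o -> R^o) (q (val p)).
  rewrite /q dot_val; apply/derivable1_diffP; apply: derivableV.
    by rewrite sqrtr1 oner_neq0.
  by have [] := @is_derive1_sqrt R 1 ltr01.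
have Nd : differentiable ((h : R^o -> R^o) \o q) (val p).
  exact: differentiable_comp.
(* The derivative of |x|^2 at p along v is 2 <v, p> = 0, so the normalising factor is stationary in
   tangent directions. *)
have N0 : 'D_v ((h : R^o -> R^o) \o q) (val p) = 0.
  rewrite (derive_comp v qd hd) (deriveE v qd) qe.
  have [_ ->] := idd.
  by rewrite vp dotC vp addr0 derive0.
(* Near p the vector x is nonzero, so [insubd] does not fall back on its default value and the
   retraction is x / |x|. *)
have e : {near val p, (fun x => ((h : R^o -> R^o) \o q) x *: x) =1
                      (fun x => val (retr x))}.
  have : \forall x \near val p, 0 < q x.
    have qc := differentiable_continuous qd.
    have q1 : 0 < q (val p) by rewrite /q dot_val.
    exact: (qc _ (lt_nbhsr q1)).
  apply: filterS => x qx; rewrite /retr val_insubd.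
  suff -> : dot ((Num.sqrt (dot x x))^-1 *: x) ((Num.sqrt (dot x x))^-1 *: x) == 1.
    by [].
  rewrite dotZl dotZr mulrA -invfM -expr2 sqr_sqrtr ?ltW //.
  by rewrite mulVf // gt_eqF.
have idd' := ex_diff (is_diff_def := idd).
split; first exact: near_eq_differentiable e (differentiable_scale Nd idd').
rewrite -(near_eq_derive _ e) (derive_scale v Nd idd') N0 scale0r add0r.
by rewrite (deriveE v idd') diff_val /= /q /h dot_val sqrtr1 invr1 scale1r.
Qed.

(** [f \o retr] is F composed with the retraction, whose derivative at p in a tangent direction is
    that direction. *)
Lemma deriv_atE W (f : S5 R -> W) (F : 'rV[R]_6 -> W) p v :
  (forall q, F (val q) = f q) -> differentiable F (val p) ->
  dot v (val p) = 0 -> deriv_at f p v = 'D_v F (val p).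
Proof.
move=> Ff Fd vp; have [rd re] := retr_is_diff vp.
have -> : deriv_at f p v = 'D_v (F \o (fun x => val (retr x))) (val p).
  by congr ('D_v _ _); apply/funext => x /=; rewrite Ff.
rewrite (derive_comp v rd); last by rewrite retr_val.
by rewrite re retr_val.
Qed.

End DirectionalDerivatives.

(** * Derivatives of fields, the bracket and the Gauss formula *)

Section CovariantDerivative.
Context {R : realType}.
Implicit Types (W : normedModType R) (p : S5 R) (X Y Z : field R).

Lemma derive_dir_sum n W (F : 'rV[R]_n -> W) x v : differentiable F x ->
  'D_v F x = \sum_j v 0 j *: 'D_(delta_mx 0 j) F x.
Proof.
move=> Fd; rewrite (deriveE v Fd) {1}(row_sum_delta v) linear_sum.
by apply: eq_bigr => j _; rewrite linearZ (deriveE _ Fd).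
Qed.

Lemma derive_dirB W (F : 'rV[R]_6 -> W) x u v : differentiable F x ->
  'D_(u - v) F x = 'D_u F x - 'D_v F x.
Proof. by move=> Fd; rewrite !(deriveE _ Fd) linearB. Qed.

Lemma Ck_on_sum n k m (U : set 'rV[R]_m) W (f : 'I_n -> 'rV[R]_m -> W) :
  open U -> (forall i, Ck_on k U (f i)) -> Ck_on k U (fun x => \sum_i f i x).
Proof.
move=> Uo fk; elim: (index_enum _) => [|i r IH].
  apply: (Ck_on_ext Uo _ (Ck_on_cst k U 0)) => x _; by rewrite big_nil.
apply: (Ck_on_ext Uo _ (Ck_on_add Uo (fk i) IH)) => x _; by rewrite big_cons.
Qed.

Lemma smooth_common_ext W W' (f : S5 R -> W) (f' : S5 R -> W') :
  smooth f -> smooth f' -> exists U F F', [/\ open U, forall p : S5 R, U (val p),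
    forall k, Ck_on k U F /\ Ck_on k U F' &
    forall p : S5 R, F (val p) = f p /\ F' (val p) = f' p].
Proof.
move=> [U [F [Uo Up Fk Ff]]] [U' [F' [Uo' Up' Fk' Ff']]].
exists (U `&` U'), F, F'; split => //; first exact: openI.
by move=> k; split; [apply: Ck_on_subset (Fk k)|apply: Ck_on_subset (Fk' k)] => x [].
Qed.

Lemma smooth_diff_ext W (f : S5 R -> W) p : smooth f ->
  exists2 F : 'rV[R]_6 -> W, differentiable F (val p) & forall q, F (val q) = f q.
Proof. by move=> [U [F [Uo Up Fk Ff]]]; exists F => //; have [+ _] := Fk 1; apply. Qed.

Lemma D_ext W X (f : S5 R -> W) (F : 'rV[R]_6 -> W) p :
  dot (X p) (val p) = 0 -> (forall q, F (val q) = f q) ->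
  differentiable F (val p) -> D X f p = 'D_(X p) F (val p).
Proof. by move=> Xp Ff Fd; exact: deriv_atE. Qed.

Section Rules.
Variables (X : field R) (p : S5 R).
Hypothesis Xp : dot (X p) (val p) = 0.

Lemma D_add W (f f' : S5 R -> W) : smooth f -> smooth f' ->
  D X (fun q => f q + f' q) p = D X f p + D X f' p.
Proof.
move=> /(smooth_diff_ext p)[F Fd Ff] /(smooth_diff_ext p)[F' Fd' Ff'].
rewrite (D_ext Xp Ff Fd) (D_ext Xp Ff' Fd') -deriveD; try exact: diff_derivable.
by apply: D_ext => // [q|]; [rewrite /= -Ff -Ff'|exact: differentiableD].
Qed.

Lemma D_opp W (f : S5 R -> W) : smooth f -> D X (fun q => - f q) p = - D X f p.
Proof.
move=> /(smooth_diff_ext p)[F Fd Ff].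
rewrite (D_ext Xp Ff Fd) -deriveN; try exact: diff_derivable.
by apply: D_ext => // [q|]; [rewrite /= -Ff|exact: differentiableN].
Qed.

Lemma D_scale W (f : S5 R -> R^o) (F : S5 R -> W) : smooth f -> smooth F ->
  D X (fun q => f q *: F q) p = (D X f p : R) *: F p + f p *: D X F p.
Proof.
move=> /(smooth_diff_ext p)[f1 fd ff] /(smooth_diff_ext p)[F1 Fd FF].
rewrite (D_ext Xp ff fd) (D_ext Xp FF Fd) -ff -FF -derive_scale //.
by apply: D_ext => // [q|]; [rewrite /= -ff -FF|exact: differentiable_scale].
Qed.

Lemma D_dot Y Z : smooth Y -> smooth Z ->
  D X (fun q => dot (Y q) (Z q) : R^o) p =
  dot (D X Y p) (Z p) + dot (Y p) (D X Z p) :> R.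
Proof.
move=> /(smooth_diff_ext p)[F Fd Ff] /(smooth_diff_ext p)[F' Fd' Ff'].
rewrite (D_ext Xp Ff Fd) (D_ext Xp Ff' Fd') -Ff -Ff' -derive_dot //.
have [d _] := dot_is_diff Fd Fd'.
by apply: (D_ext Xp _ d) => q; rewrite Ff Ff'.
Qed.

Lemma D_val : D X (fun q => val q) p = X p.
Proof.
have d : differentiable (id : 'rV[R]_6 -> 'rV[R]_6) (val p).
  exact: (ex_diff (is_diff_def := is_diff_id _)).
by rewrite (@D_ext _ _ _ id) //; exact: derive_id.
Qed.

Lemma D_cst W (w : W) : D X (fun=> w) p = 0.
Proof.
by rewrite (@D_ext _ _ _ (fun=> w)) //; exact: derive_cst.
Qed.

End Rules.

(** Differentiating <Y, p> = 0 along X gives the second fundamental form of the sphere; this normal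
    part is what [nabla0] removes. *)
Lemma dot_D_val X Y p : smooth Y -> dot (X p) (val p) = 0 ->
  (forall q, dot (Y q) (val q) = 0) -> dot (D X Y p) (val p) = - dot (X p) (Y p).
Proof.
move=> Ys Xp Yt; have := D_dot Xp Ys (@smooth_val R).
have -> : (fun q => dot (Y q) (val q) : R^o) = fun=> 0 by apply/funext.
rewrite D_cst // D_val // [dot (Y p) _]dotC => /esym/eqP.
by rewrite addr_eq0 => /eqP.
Qed.

Lemma smooth_D X Y : vector_field X -> smooth Y -> smooth (D X Y).
Proof.
move=> [Xs Xt] Ys; have [U [Xe [Ye [Uo Up XYk XYe]]]] := smooth_common_ext Xs Ys.
(* A derivative along a variable direction is expanded in coordinates, so that its smoothness
   reduces to sums and products of smooth maps. *)
exists U, (fun x => \sum_j Xe x 0 j *: 'D_(delta_mx 0 j) Ye x); split => //.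
  move=> k; have [Xk _] := XYk k; have [_ [_ Yk]] := XYk k.+1.
  apply: Ck_on_sum => // j; apply: (Ck_on_scale Uo _ (Yk _)).
  by apply: (@Ck_on_lin_comp _ _ R^o _ _ _ (fun v => v 0 j)) => // c u v; rewrite !mxE.
move=> p; have [[_ [Yd _]] [Xep _]] := (XYk 1, XYe p).
have Ydp := Yd _ (Up p).
by rewrite -derive_dir_sum // Xep (D_ext _ _ Ydp) // => q; have [] := XYe q.
Qed.

(** The product rule is applied to the coordinate expansion of y |-> D_{Y(y)} Z(y); symmetry of
    second derivatives then brings the derivative along w inside. *)
Lemma derive_dir_field (U : set 'rV[R]_6) (Y Z : 'rV[R]_6 -> 'rV[R]_6) x w :
  open U -> U x -> (forall k, Ck_on k U Y) -> (forall k, Ck_on k U Z) ->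
  'D_w (fun y => \sum_j Y y 0 j *: 'D_(delta_mx 0 j) Z y) x =
  'D_('D_w Y x) Z x + 'D_(Y x) ('D_w Z) x.
Proof.
move=> Uo Ux Yk Zk; have [Yd _] := Yk 1; have [Zd ZD] := Zk 2.
have cd j : differentiable (fun y => Y y 0 j : R^o) x.
  apply: (@differentiable_comp _ _ _ _ Y (fun v => v 0 j : R^o)); first exact: Yd.
  exact: differentiable_coord.
have zd j : differentiable ('D_(delta_mx 0 j) Z) x by have [+ _] := ZD (delta_mx 0 j); apply.
have -> : (fun y => \sum_j Y y 0 j *: 'D_(delta_mx 0 j) Z y) =
    \sum_j (fun y => Y y 0 j *: 'D_(delta_mx 0 j) Z y).
  by apply/funext => y; rewrite fct_sumE.
rewrite derive_sum; last first.
  by move=> j; apply: diff_derivable; exact: differentiable_scale (cd j) (zd j).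
rewrite (derive_dir_sum _ (Zd x Ux)) (@derive_dir_sum _ _ ('D_w Z)); last first.
  by have [+ _] := ZD w; apply.
rewrite -big_split; apply: eq_bigr => j _ /=.
rewrite (derive_scale w (cd j) (zd j)) (derive_swap _ _ Uo Ux (Zk 3)).
congr (_ *: _ + _).
have cl : linear (fun v : 'rV[R]_6 => v 0 j : R^o) by move=> k u v; rewrite !mxE.
have [ld le] := linear_rV_is_diff (Y x) cl.
by rewrite (derive_comp w (Yd x Ux) ld) (deriveE _ ld) le.
Qed.

(** Each iterated derivative splits into a first-order term and the Hessian of the extension of Z on
    (X, Y); the Hessians cancel. The vectors D_X Y and D_Y X need not be tangent, so the first-order
    terms are kept on the extension until the difference, which is tangent, is formed. *)
Lemma D_lie X Y Z p : vector_field X -> vector_field Y -> smooth Z ->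
  D X (D Y Z) p - D Y (D X Z) p = D (lie X Y) Z p.
Proof.
move=> [Xs Xt] [Ys Yt] Zs.
have [U1 [Xe [Ye [U1o U1p XYk XYe]]]] := smooth_common_ext Xs Ys.
have [U2 [Ze [U2o U2p ZZk ZZe]]] := Zs.
pose U := U1 `&` U2; have Uo : open U by exact: openI.
have Up (q : S5 R) : U (val q) by split; [exact: U1p|exact: U2p].
have Xk k : Ck_on k U Xe by apply: Ck_on_subset (XYk k).1 => x [].
have Yk k : Ck_on k U Ye by apply: Ck_on_subset (XYk k).2 => x [].
have Zk k : Ck_on k U Ze by apply: Ck_on_subset (ZZk k) => x [].
have Zd x : U x -> differentiable Ze x by have [+ _] := Zk 1; apply.
have DD (A B : field R) (Ae : 'rV[R]_6 -> 'rV[R]_6) : (forall q, dot (A q) (val q) = 0) ->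
    (forall k, Ck_on k U Ae) -> (forall q, Ae (val q) = A q) -> dot (B p) (val p) = 0 ->
    D B (D A Z) p =
    'D_(D B A p) Ze (val p) + 'D_(A p) ('D_(B p) Ze) (val p).
  move=> At Ak AAe Bp; have [Ad _] := Ak 1.
  have ZD v : Ck_on 1 U ('D_v Ze) by have [_] := Zk 2; apply.
  pose E x := \sum_j Ae x 0 j *: 'D_(delta_mx 0 j) Ze x.
  have Ek : Ck_on 1 U E.
    apply: Ck_on_sum => // j; apply: (Ck_on_scale Uo _ (ZD _)).
    by apply: (@Ck_on_lin_comp _ _ R^o _ _ _ (fun v => v 0 j)) => //; move=> c u v; rewrite !mxE.
  have [Ed _] := Ek.
  have EE q : E (val q) = D A Z q.
    rewrite /E -derive_dir_sum; last exact: Zd.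
    rewrite AAe (D_ext (At q) _ (Zd _ (Up q))) // => q' => q'; exact: ZZe.
  rewrite (D_ext Bp EE (Ed _ (Up p))) (derive_dir_field _ Uo (Up p) Ak Zk) AAe.
  by rewrite (D_ext Bp AAe (Ad _ (Up p))).
have Zde : D (lie X Y) Z p = 'D_(lie X Y p) Ze (val p).
  apply: D_ext; [|exact: ZZe|exact: Zd].
  by rewrite /lie dotBl !dot_D_val // [dot (Y p) _]dotC opprK addNr.
have XeX q : Xe (val q) = X q by have [] := XYe q.
have YeY q : Ye (val q) = Y q by have [] := XYe q.
rewrite (DD Y X Ye) // (DD X Y Xe) // Zde derive_dirB; last exact: Zd.
have cancel (a b c d : 'rV[R]_6) : b = d -> a + b - (c + d) = a - c.
  by move=> ->; rewrite opprD addrACA subrr addr0.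
exact: cancel (derive_swap (X p) (Y p) Uo (Up p) (Zk 3)).
Qed.

(* The Gauss formula for the round metric. *)
Definition nabla0 X Y : field R := fun p => D X Y p + dot (X p) (Y p) *: val p.

Lemma smooth_tfield (v : 'rV[R]_6) : smooth (tfield v : field R).
Proof.
apply: smooth_sub; first exact: smooth_cst.
apply: smooth_scale; last exact: smooth_val.
by apply: smooth_dot; [exact: smooth_cst|exact: smooth_val].
Qed.

Lemma dot_tproj_val p v : dot (tproj p v) (val p) = 0.
Proof. by rewrite /tproj dotBl dotZl dot_val mulr1 subrr. Qed.

Lemma dot_tproj p v w : dot v (val p) = 0 -> dot v (tproj p w) = dot v w.
Proof. by move=> vp; rewrite /tproj dotBr dotZr vp mulr0 subr0. Qed.

Lemma tproj_tangent p v : dot v (val p) = 0 -> tproj p v = v.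
Proof. by move=> vp; rewrite /tproj vp scale0r subr0. Qed.

Lemma tfield_vf (v : 'rV[R]_6) : vector_field (tfield v : field R).
Proof. by split; [exact: smooth_tfield|move=> p; exact: dot_tproj_val]. Qed.

Lemma vf_add X Y : vector_field X -> vector_field Y ->
  vector_field (fun p => X p + Y p).
Proof.
move=> [Xs Xt] [Ys Yt]; split; first exact: smooth_add.
by move=> p; rewrite dotDl Xt Yt addr0.
Qed.

Lemma vf_sub X Y : vector_field X -> vector_field Y ->
  vector_field (fun p => X p - Y p).
Proof.
move=> [Xs Xt] [Ys Yt]; split; first exact: smooth_sub.
by move=> p; rewrite dotBl Xt Yt subr0.
Qed.

Lemma vf_scale (f : S5 R -> R^o) X : smooth f -> vector_field X ->
  vector_field (fun p => f p *: X p).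
Proof.
move=> fs [Xs Xt]; split; first exact: smooth_scale.
by move=> p; rewrite dotZl Xt mulr0.
Qed.

Lemma nabla0_vf X Y : vector_field X -> vector_field Y -> vector_field (nabla0 X Y).
Proof.
move=> Xv Yv; have [[Xs Xt] [Ys Yt]] := (Xv, Yv); split.
  apply: smooth_add; first exact: smooth_D.
  by apply: smooth_scale; [exact: smooth_dot|exact: smooth_val].
by move=> p; rewrite /nabla0 dotDl dotZl dot_val mulr1 dot_D_val // addNr.
Qed.

Lemma lieE X Y : lie X Y = fun p => nabla0 X Y p - nabla0 Y X p.
Proof.
apply/funext => p; rewrite /lie /nabla0 [dot (Y p) _]dotC.
have cancel (a b c : 'rV[R]_6) : a - b = a + c - (b + c).
  by rewrite opprD addrACA subrr addr0.
exact: cancel.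
Qed.

Lemma lie_vf X Y : vector_field X -> vector_field Y -> vector_field (lie X Y).
Proof. by move=> Xv Yv; rewrite lieE; apply: vf_sub; exact: nabla0_vf. Qed.

Lemma nabla0_metric : metric (@nabla0).
Proof.
have n0 A B p w : dot w (val p) = 0 -> dot (nabla0 A B p) w = dot (D A B p) w.
  by move=> wp; rewrite /nabla0 dotDl dotZl [dot (val p) _]dotC wp mulr0 addr0.
move=> X Y Z [_ Xt] [Ys Yt] [Zs Zt] p; rewrite /g (n0 _ _ _ _ (Zt p)).
by rewrite [dot (Y p) _]dotC (n0 _ _ _ _ (Yt p)) [dot _ (Y p)]dotC; exact: D_dot.
Qed.

(* The difference of two such connections gives a trilinear form which is symmetric
   in X, Y and skew in Y, Z, hence zero. *)
Lemma levi_civitaE (nablag : field R -> field R -> field R) X Y :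
  levi_civita nablag -> vector_field X -> vector_field Y -> nablag X Y = nabla0 X Y.
Proof.
move=> [afg mg tg] Xv Yv.
pose a A B C p := dot (nablag A B p - nabla0 A B p) (C p).
have a_sym A B C p : vector_field A -> vector_field B -> a A B C p = a B A C p.
  move=> Av Bv; have := tg A B Av Bv p; rewrite /torsion lieE /a.
  move: (nablag A B p) (nablag B A p) (nabla0 A B p) (nabla0 B A p) => s t u v e.
  congr dot; apply/rowP => j; move/rowP/(_ j): e; rewrite !mxE; lra.
have a_skew A B C p : vector_field A -> vector_field B -> vector_field C ->
    a A B C p = - a A C B p.
  move=> Av Bv Cv; have := mg A B C Av Bv Cv p.
  rewrite (nabla0_metric Av Bv Cv) /g /a !dotBl ![dot (B p) _]dotC; lra.
have a0 A B C p : vector_field A -> vector_field B -> vector_field C -> a A B C p = 0.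
  move=> Av Bv Cv.
  have := a_skew A B C p Av Bv Cv; have := a_sym A C B p Av Cv.
  have := a_skew C A B p Cv Av Bv; have := a_sym C B A p Cv Bv.
  have := a_skew B C A p Bv Cv Av; have := a_sym B A C p Bv Av; lra.
apply/funext => p; apply/eqP; rewrite -subr_eq0; apply/eqP/dot_eq0.
have [_ gt] := conn_vf afg Xv Yv; have [_ n0t] := nabla0_vf Xv Yv.
have := a0 X Y (tfield (nablag X Y p - nabla0 X Y p)) p Xv Yv (tfield_vf _).
by rewrite /a /tfield tproj_tangent // dotBl gt n0t subr0.
Qed.

End CovariantDerivative.

(** * The symmetric Ricci tensor *)

Section Ricci.
Context {R : realType}.
Implicit Types (p : S5 R) (X Y Z W : field R).
Local Notation E i := (tfield (delta_mx 0 i)).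

(* The metric connections with skew torsion, through A = half of the torsion. *)
Record skew_difference (nabla A : field R -> field R -> field R) : Prop := {
  skd_conn : forall X Y, vector_field X -> vector_field Y ->
    nabla X Y = fun p => nabla0 X Y p + A X Y p;
  skd_vf : forall X Y, vector_field X -> vector_field Y -> vector_field (A X Y);
  skd_subl : forall X X' Y p, vector_field X -> vector_field X' -> vector_field Y ->
    A (fun q => X q - X' q) Y p = A X Y p - A X' Y p;
  skd_alt23 : forall X Y Z p, vector_field X -> vector_field Y -> vector_field Z ->
    dot (A X Y p) (Z p) = - dot (A X Z p) (Y p);
  skd_alt12 : forall X Y Z p, vector_field X -> vector_field Y -> vector_field Z ->
    dot (A X Y p) (Z p) = - dot (A Y X p) (Z p) }.

(** Parseval identity: pairing a tangent vector with E_i reads off its i-th coordinate in R^6. *)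
Lemma sum_dot_tfield p u v : dot u (val p) = 0 -> dot v (val p) = 0 ->
  \sum_i dot u (E i p) * dot v (E i p) = dot u v.
Proof.
move=> up vp; rewrite dotE; apply: eq_bigr => i _.
by rewrite /tfield !dot_tproj // !dot_delta.
Qed.

(** Here |E_i|^2 = 1 - p_i^2, and the sum is the trace 6 - 1 of the tangent projection. *)
Lemma sum_norm_tfield p : \sum_i dot (E i p) (E i p) = 5%:R :> R.
Proof.
have e i : dot (E i p) (E i p) = 1 - val p 0 i * val p 0 i.
  rewrite dot_tproj ?dot_tproj_val // dot_delta /tfield /tproj mxE [in X in _ + X]mxE.
  by rewrite mxE [dot _ _]dotC dot_delta mxE !eqxx.
rewrite (eq_bigr _ (fun i _ => e i)) sumrB -dotE dot_val sumr_const card_ord.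
by rewrite -[1]/(1%:R) -natrB.
Qed.

Lemma nabla_vf nabla A X Y : skew_difference nabla A ->
  vector_field X -> vector_field Y -> vector_field (nabla X Y).
Proof.
move=> H Xv Yv; rewrite (skd_conn H) //.
by apply: vf_add; [exact: nabla0_vf|exact: skd_vf H _ _ _ _].
Qed.

(** The i-th diagonal entry is the i-th coordinate of the curvature at E_i; since that vector is
    tangent, this coordinate is its product with E_i. *)
Lemma RicE nabla A Y Z p : skew_difference nabla A ->
  vector_field Y -> vector_field Z ->
  Ric nabla Y Z p = \sum_i dot (curv nabla (E i) Y Z p) (E i p).
Proof.
move=> H Yv Zv; rewrite /Ric /mxtrace; apply: eq_bigr => i _.
have Ev := tfield_vf (delta_mx 0 i : 'rV[R]_6).
rewrite mxE dot_tproj ?dot_delta //; rewrite /curv !dotBl.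
have vt X Y' q : vector_field X -> vector_field Y' -> dot (nabla X Y' q) (val q) = 0.
  by move=> Xv Yv'; have [_] := nabla_vf H Xv Yv'; apply.
by rewrite !vt ?subrr //; try exact: (nabla_vf H); exact: lie_vf.
Qed.

Section CurvatureTerm.
Variables (nabla A : field R -> field R -> field R).
Hypothesis H : skew_difference nabla A.
Variables (X : field R) (p : S5 R).
Hypothesis Xv : vector_field X.

Let nabla0_dot B C w : dot w (val p) = 0 -> dot (nabla0 B C p) w = dot (D B C p) w.
Proof. by move=> wp; rewrite /nabla0 dotDl dotZl [dot (val p) _]dotC wp mulr0 addr0. Qed.

Let A_cyclic B C F : vector_field B -> vector_field C -> vector_field F ->
  dot (A B C p) (F p) = dot (A F B p) (C p).
Proof.
move=> Bv Cv Fv.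
by rewrite (skd_alt23 H p Bv Cv Fv) (skd_alt12 H p Bv Fv Cv) opprK.
Qed.

Let A_self B C : vector_field B -> vector_field C -> dot (A B C p) (B p) = 0.
Proof.
move=> Bv Cv; have := A_cyclic Bv Cv Bv; have := skd_alt12 H p Bv Bv Cv; lra.
Qed.

Let collect (a b c d e f h i j k : R) : a - b = c ->
  (a + d + e) - (b + f - h + i + j) - (c - k + h) = d - f + e + (k - i) - j.
Proof. by move=> <-; ring. Qed.

(** The first two terms on the right are the curvature of the unit sphere. Total skewness turns
    every A taken along Y or along the bracket into an A taken along X; the two terms containing D_Y
    X then cancel, and [D_lie] absorbs the second derivatives of Z. *)
Lemma dot_curv_skew Y Z : vector_field Y -> vector_field Z ->
  dot (curv nabla X Y Z p) (X p) =
  dot (Y p) (Z p) * dot (X p) (X p) - dot (X p) (Z p) * dot (Y p) (X p)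
  + dot (D X (A Y Z) p) (X p)
  + (dot (A X Z p) (D X Y p) - dot (A X Y p) (D X Z p))
  - dot (A X Y p) (A X Z p).
Proof.
move=> Yv Zv; have [[Xs Xt] [Ys Yt] [Zs Zt]] := And3 Xv Yv Zv.
have Av := skd_vf H; have nv := @nabla_vf _ _ _ _ H; have Lv := lie_vf Xv Yv.
have DnE B C F : vector_field B -> vector_field C -> vector_field F ->
    D B (nabla C F) p = D B (D C F) p + (D B (fun q => dot (C q) (F q) : R^o) p : R) *: val p
      + dot (C p) (F p) *: B p + D B (A C F) p.
  move=> Bv Cv Fv; have [[Bs Bt] [Cs Ct] [Fs Ft]] := And3 Bv Cv Fv.
  have ds : smooth (fun q => dot (C q) (F q) : R^o) by exact: smooth_dot.
  have dvs := smooth_scale ds (@smooth_val R).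
  have [n0s _] := nabla0_vf Cv Fv; have [As _] := Av _ _ Cv Fv.
  rewrite (skd_conn H) // (D_add (Bt p) n0s As) (D_add (Bt p) (smooth_D Cv Fs) dvs).
  by rewrite (D_scale (Bt p) ds (@smooth_val R)) (D_val (Bt p)) !addrA.
have At C F : vector_field C -> vector_field F -> dot (A C F p) (val p) = 0.
  by move=> Cv Fv; have [_] := Av _ _ Cv Fv; apply.
have e1 : dot (nabla X (nabla Y Z) p) (X p) =
    dot (D X (D Y Z) p) (X p) + dot (Y p) (Z p) * dot (X p) (X p)
    + dot (D X (A Y Z) p) (X p).
  rewrite (skd_conn H Xv (nv _ _ Yv Zv)) dotDl A_self ?addr0 //; last exact: nv.
  rewrite nabla0_dot // DnE // !dotDl !dotZl [dot (val p) _]dotC Xt mulr0 addr0.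
  by [].
have e2 : dot (nabla Y (nabla X Z) p) (X p) =
    dot (D Y (D X Z) p) (X p) + dot (X p) (Z p) * dot (Y p) (X p)
    - dot (A X Z p) (D Y X p) + dot (A X Y p) (D X Z p) + dot (A X Y p) (A X Z p).
  rewrite (skd_conn H Yv (nv _ _ Xv Zv)) dotDl (A_cyclic Yv (nv _ _ Xv Zv) Xv).
  rewrite nabla0_dot // DnE // !dotDl !dotZl [dot (val p) _]dotC Xt mulr0 addr0.
  rewrite (skd_conn H Xv Zv) dotDr [dot (A X Y p) (nabla0 _ _ _)]dotC.
  rewrite nabla0_dot ?At // [dot (D X Z p) _]dotC.
  have [As _] := Av _ _ Xv Zv.
  (* This function is zero on the whole sphere, not just at p, so the Leibniz rule along Y transfers
     the derivative from A(X, Z) to X. *)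
  have h0 : (fun q => dot (A X Z q) (X q) : R^o) = fun=> 0.
    apply/funext => q; have := skd_alt23 H q Xv Zv Xv.
    by have := skd_alt12 H q Xv Xv Zv; lra.
  have -> : dot (D Y (A X Z) p) (X p) = - dot (A X Z p) (D Y X p).
    apply/eqP; rewrite -addr_eq0 -(D_dot (Yt p) As Xs) h0 D_cst //.
  rewrite addrA; congr (_ + _ + _); rewrite dotC; exact: erefl.
have e3 : dot (nabla (lie X Y) Z p) (X p) =
    dot (D (lie X Y) Z p) (X p) - dot (A X Z p) (D X Y p) + dot (A X Z p) (D Y X p).
  rewrite (skd_conn H Lv Zv) dotDl nabla0_dot // (A_cyclic Lv Zv Xv).
  rewrite (skd_alt23 H p Xv Lv Zv) /lie dotBr opprB addrA addrAC; exact: erefl.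
have := D_lie p Xv Yv Zs => /(congr1 (fun w => dot w (X p))); rewrite dotBl.
rewrite /curv !dotBl e1 e2 e3; exact: collect.
Qed.

End CurvatureTerm.

(* In dot_curv_skew every term with a derivative of A, Y or Z is antisymmetric
   in Y, Z. *)
Lemma SymRic_skew nabla A Y Z p : skew_difference nabla A ->
  vector_field Y -> vector_field Z ->
  SymRic nabla Y Z p =
  4 * dot (Y p) (Z p) - \sum_i dot (A (E i) Y p) (A (E i) Z p).
Proof.
move=> H Yv Zv; rewrite /SymRic !(RicE _ H) // -big_split /=.
have [[Ys Yt] [Zs Zt]] := (Yv, Zv).
have -> : \sum_i (dot (curv nabla (E i) Y Z p) (E i p) +
                  dot (curv nabla (E i) Z Y p) (E i p)) =
  \sum_i (2 * (dot (Y p) (Z p) * dot (E i p) (E i p))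
          - 2 * (dot (Y p) (E i p) * dot (Z p) (E i p))
          - 2 * dot (A (E i) Y p) (A (E i) Z p)).
  apply: eq_bigr => i _; have Ev := tfield_vf (delta_mx 0 i : 'rV[R]_6).
  rewrite (dot_curv_skew H p Ev Yv Zv) (dot_curv_skew H p Ev Zv Yv).
  (* Alternation is known only after pairing with a vector field; the pairing is done with the field
     that extends the difference w itself, which makes |w|^2 vanish. *)
  have AZY : A Z Y = fun q => - A Y Z q.
    apply/funext => q; apply/eqP; rewrite -subr_eq0; apply/eqP/dot_eq0.
    set w := _ - _.
    have wt : dot w (val q) = 0.
      have [_ t1] := skd_vf H Zv Yv; have [_ t2] := skd_vf H Yv Zv.
      by rewrite /w dotBl dotNl t1 t2 oppr0 subr0.
    rewrite -{2}(tproj_tangent wt) -/(tfield w q) /w dotBl dotNl.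
    by rewrite (skd_alt12 H q Zv Yv (tfield_vf _)) subrr.
  have [As _] := skd_vf H Yv Zv; have [_ Et] := Ev.
  rewrite AZY (D_opp (Et p) As) dotNl [dot (Z p) (Y p)]dotC.
  rewrite [dot (A (E i) Z p) (A (E i) Y p)]dotC.
  rewrite [dot (Y p) (E i p)]dotC [dot (Z p) (E i p)]dotC; lra.
(* The coefficient 4 arises here: the norms of the E_i contribute 5, the Parseval sum subtracts
   1. *)
rewrite !sumrB -!mulr_sumr sum_dot_tfield // sum_norm_tfield; lra.
Qed.

End Ricci.

(** * The invariant family *)

Section Coordinates.
Context {R : realType}.
Implicit Types u v w : 'rV[R]_6.

(* The complex-antilinear cross product of C^3 in the coordinates of Defs. *)
Definition ccross u v : 'rV[R]_6 :=
  let m j k := u 0 (inord j) * v 0 (inord k) - u 0 (inord k) * v 0 (inord j) in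
  \row_j [:: m 4%N 5%N + m 1%N 3%N; m 3%N 0%N + m 2%N 4%N; m 4%N 1%N + m 3%N 5%N;
             m 0%N 1%N + m 5%N 2%N; m 1%N 2%N + m 5%N 0%N; m 2%N 3%N + m 0%N 4%N]`_j.

Lemma rV6P u v : (forall k, (k < 6)%N -> u 0 (inord k) = v 0 (inord k)) -> u = v.
Proof. by move=> uv; apply/rowP => j; rewrite -(inord_val j) uv. Qed.

Lemma dot6E u v : dot u v =
  u 0 (inord 0) * v 0 (inord 0) + u 0 (inord 1) * v 0 (inord 1) +
  u 0 (inord 2) * v 0 (inord 2) + u 0 (inord 3) * v 0 (inord 3) +
  u 0 (inord 4) * v 0 (inord 4) + u 0 (inord 5) * v 0 (inord 5).
Proof.
rewrite dotE (eq_bigr (fun j : 'I_6 => u 0 (inord j) * v 0 (inord j))).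
  by rewrite !big_ord_recl big_ord0 /= /bump /= addr0 !addrA.
by move=> j _; rewrite inord_val.
Qed.

(** Multiplication by i in real coordinates: e_7 sends e_1, e_2, e_4 to e_3, e_6, e_5, which pairs
    the indices (0, 2), (1, 5) and (3, 4). *)
Definition rot u : 'rV[R]_6 :=
  \row_j [:: - u 0 (inord 2); - u 0 (inord 5); u 0 (inord 0);
             - u 0 (inord 4); u 0 (inord 3); u 0 (inord 1)]`_j.

Lemma muli_rot u : muli u = rot u.
Proof.
by apply: rV6P; case=> [|[|[|[|[|[|//]]]]]] _;
  rewrite /muli /ofC /toC !mxE !inordK //= ?mxE ?inordK //=; ring.
Qed.

Lemma rotE u : ((rot u 0 (inord 0) = - u 0 (inord 2)) *
  (rot u 0 (inord 1) = - u 0 (inord 5)) * (rot u 0 (inord 2) = u 0 (inord 0)) *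
  (rot u 0 (inord 3) = - u 0 (inord 4)) * (rot u 0 (inord 4) = u 0 (inord 3)) *
  (rot u 0 (inord 5) = u 0 (inord 1)))%type.
Proof. by do ![split]; rewrite !mxE !inordK. Qed.

Lemma ccrossE u v (m := fun j k => u 0 (inord j) * v 0 (inord k) - u 0 (inord k) * v 0 (inord j)) :
  ((ccross u v 0 (inord 0) = (m 4%N 5%N + m 1%N 3%N)%R) *
   (ccross u v 0 (inord 1) = (m 3%N 0%N + m 2%N 4%N)%R) *
   (ccross u v 0 (inord 2) = (m 4%N 1%N + m 3%N 5%N)%R) *
   (ccross u v 0 (inord 3) = (m 0%N 1%N + m 5%N 2%N)%R) *
   (ccross u v 0 (inord 4) = (m 1%N 2%N + m 5%N 0%N)%R) *
   (ccross u v 0 (inord 5) = (m 2%N 3%N + m 0%N 4%N)%R))%type.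
Proof. by do ![split]; rewrite !mxE !inordK. Qed.

Lemma muli_linear : linear (@muli R).
Proof.
move=> k u v; rewrite !muli_rot; apply: rV6P; case=> [|[|[|[|[|[|//]]]]]] _;
  by rewrite [RHS]mxE [X in _ = X + _]mxE !rotE ![(_ *: u + v) _ _]mxE ![(_ *: u) _ _]mxE; ring.
Qed.

Lemma muliK u : muli (muli u) = - u.
Proof.
rewrite !muli_rot; apply: rV6P; case=> [|[|[|[|[|[|//]]]]]] _;
  by rewrite [RHS]mxE !rotE ?opprK.
Qed.

Lemma dot_muli u v : dot (muli u) v = - dot u (muli v).
Proof. by rewrite !muli_rot !dot6E !rotE; ring. Qed.

Lemma ccross_linearr u : linear (ccross u).
Proof.
move=> k v w; apply: rV6P; case=> [|[|[|[|[|[|//]]]]]] _;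
  by rewrite [RHS]mxE [X in _ = X + _]mxE !ccrossE ![(_ *: v + w) _ _]mxE ![(_ *: v) _ _]mxE; ring.
Qed.

Lemma ccrossC u v : ccross u v = - ccross v u.
Proof.
apply: rV6P; case=> [|[|[|[|[|[|//]]]]]] _; by rewrite [RHS]mxE !ccrossE; ring.
Qed.

Lemma ccross_linearl v : linear (ccross^~ v).
Proof.
by move=> k u w; rewrite ccrossC ccross_linearr opprD -scalerN -!ccrossC.
Qed.

Lemma dot_ccross u v w : dot (ccross u v) w = - dot v (ccross u w).
Proof. by rewrite !dot6E !ccrossE; ring. Qed.

Lemma ccrossxx u : ccross u u = 0.
Proof.
apply: rV6P; case=> [|[|[|[|[|[|//]]]]]] _; by rewrite [RHS]mxE !ccrossE; ring.
Qed.

Lemma ccross_muli u v : ccross u (muli v) = - muli (ccross u v).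
Proof.
rewrite !muli_rot; apply: rV6P; case=> [|[|[|[|[|[|//]]]]]] _;
  by rewrite [RHS]mxE !rotE !ccrossE !rotE; ring.
Qed.

(* The Hermitian Lagrange identity. *)
Lemma dot_ccross2 u v w : dot (ccross u v) (ccross u w) =
  dot u u * dot v w - dot v u * dot w u - dot v (muli u) * dot w (muli u).
Proof. by rewrite !muli_rot !dot6E !ccrossE !rotE; ring. Qed.

(** The octonion product of two vectors of C^3 consists of a part in the span of 1 and e_7 and of
    their antilinear cross product. The imaginary part and the projection along [nu] discard the
    former; the proof compares the multiplication table with [ccross]. *)
Lemma psihatE (p : S5 R) u : psihat p u = ccross (val p) u.
Proof.
apply/rowP => j.
have nu0 : (nu R) 0 (inord j.+1) = 0.
  by rewrite mxE oeE inordK ?ltnS ?(ltnW (ltn_ord j)) //= eqSS ltn_eqF ?oppr0.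
rewrite orestrE mxE [X in _ + X]mxE [X in _ - X]mxE nu0 mulr0 subr0.
rewrite /Jmap /oIm mxE [X in _ + X]mxE [X in _ - X]mxE /o1.
rewrite [delta_mx _ _ _ _]mxE eqxx -val_eqE /= inordK ?ltnS ?(ltnW (ltn_ord j)) //= mulr0 subr0.
rewrite /omul summxE.
under eq_bigr => k _.
  rewrite summxE; under eq_bigr => l _ do rewrite mxE !oembE.
  over.
have oE k l : oe R k 0 l = ((l : nat) == ((k + 6) %% 7).+1)%:R by rewrite oeE.
have oNE k l : (- oe R k) 0 l = - ((l : nat) == ((k + 6) %% 7).+1)%:R by rewrite mxE oE.
have o1E l : (- o1 R) 0 l = - ((l : nat) == 0%N)%:R.
  by rewrite /o1 !mxE eqxx -val_eqE.
rewrite !big_ord_recl !big_ord0 /omul_basis /= !(mul0r, mulr0, add0r, addr0).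
rewrite !(oE, oNE, o1E).
case: j {nu0} => [[|[|[|[|[|[|//]]]]]] jP] /=; rewrite !inordK //= !mxE /= /bump /=;
  rewrite !(add0n, addn0, add1n) /=; ring.
Qed.

End Coordinates.

(** * The torsion tensor from quaternionic relations *)

Section QuaternionicTensor.
Context {R : realType}.

(** Scalar form of the product of A(e, u) and A(e, v): he, hu, hv are values of eta, fe, fu, fv are
    values of F, x is xi, and gu, gv are the products of F e with u and v. *)
Let dot_tensor_pair (he hu hv gu gv s ue ve ee : R) (fe fu fv x : 'rV[R]_6) :
  dot fu fe = s * (ue - hu * he) -> dot fe fv = s * (ve - he * hv) ->
  dot fe fe = s * (ee - he * he) ->
  dot fu x = 0 -> dot fv x = 0 -> dot fe x = 0 -> dot x x = 1 ->
  dot (he *: fu - hu *: fe + gu *: x) (he *: fv - hv *: fe + gv *: x) =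
  dot fu fv * (he * he) - s * hv * (he * ue) - s * hu * (he * ve)
  + 2 * s * (hu * hv) * (he * he) + hu * hv * s * (ee - he * he) + gu * gv.
Proof.
move=> ufe fev fee fux fvx fex xx.
rewrite !(dotBl, dotBr, dotDl, dotDr, dotZl, dotZr) [dot x fv]dotC [dot x fe]dotC.
by rewrite ufe fev fee fux fvx fex xx; ring.
Qed.

Variables (J C : 'rV[R]_6 -> 'rV[R]_6) (r a b : R) (p : S5 R).
Implicit Types u v w : 'rV[R]_6.
Local Notation E i := (tfield (delta_mx 0 i)).

Definition qxi : 'rV[R]_6 := - J (val p).
Definition qeta u : R := dot (J u) (val p).

(* On the orthogonal of p and qxi this is an orthogonal map scaled by the square
   root of r^2 + a^2 + b^2, because J, C and J C satisfy the quaternionic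
   relations there. *)
Definition qend u : 'rV[R]_6 :=
  b *: C u - a *: J (C u) - r *: (J u - qeta u *: val p).

Definition qtensor u v : 'rV[R]_6 :=
  qeta u *: qend v - qeta v *: qend u + dot (qend u) v *: qxi.

Hypothesis J_linear : linear J.
Hypothesis C_linear : linear C.
Hypothesis JK : forall u, J (J u) = - u.
Hypothesis dot_J : forall u v, dot (J u) v = - dot u (J v).
Hypothesis dot_C : forall u v, dot (C u) v = - dot u (C v).
Hypothesis CJ : forall u, C (J u) = - J (C u).
Hypothesis C_val : C (val p) = 0.
Hypothesis dot_CC : forall u v, dot (C u) (C v) =
  dot u v - dot u (val p) * dot v (val p) - dot u (J (val p)) * dot v (J (val p)).

Let J0 : J 0 = 0.
Proof. by have := J_linear (-1) 0 0; rewrite !scaleN1r oppr0 addr0 addNr. Qed.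

Let CJ_val : C (J (val p)) = 0.
Proof. by rewrite CJ C_val J0 oppr0. Qed.

Let dot_C_val u : dot (C u) (val p) = 0.
Proof. by rewrite dot_C C_val dot0r oppr0. Qed.

Let dot_C_J u : dot (C u) (J (val p)) = 0.
Proof. by rewrite dot_C CJ_val dot0r oppr0. Qed.

Let dot_JJ u v : dot (J u) (J v) = dot u v.
Proof. by rewrite dot_J JK dotNr opprK. Qed.

Let dot_J_val : dot (J (val p)) (val p) = 0.
Proof. have := dot_J (val p) (val p); rewrite [dot (val p) _]dotC; lra. Qed.

Let qeta_qxi u : qeta u = dot qxi u.
Proof. by rewrite /qeta /qxi dot_J dotC dotNl. Qed.

Let dot_qxi_val : dot qxi (val p) = 0.
Proof. by rewrite /qxi dotNl dot_J_val oppr0. Qed.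

Let dot_qxi_qxi : dot qxi qxi = 1.
Proof. by rewrite /qxi dotNl dotNr opprK dot_JJ dot_val. Qed.

Lemma qend_linear : linear qend.
Proof.
move=> k u v; rewrite /qend /qeta C_linear !J_linear dotDl dotZl.
apply/rowP => j; rewrite !mxE; ring.
Qed.

Lemma qend_tangent u : dot (qend u) (val p) = 0.
Proof.
rewrite /qend !dotBl !dotZl dotBl dotZl dot_val dot_C_val.
by rewrite [dot (J (C u)) _]dot_J dot_C_J /qeta; ring.
Qed.

Let qend_horizontal u : dot u (val p) = 0 -> dot (qend u) qxi = 0.
Proof.
move=> up; rewrite /qend /qxi dotNr !dotBl !dotZl dotBl dotZl dot_C_J.
by rewrite !dot_JJ dot_C_val up [dot (val p) _]dotC dot_J_val; ring.
Qed.

Let qend_skew u v : dot u (val p) = 0 -> dot v (val p) = 0 ->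
  dot (qend u) v = - dot (qend v) u.
Proof.
move=> up vp.
have e1 : dot (C u) v = - dot (C v) u by rewrite dot_C dotC.
have e2 : dot (J u) v = - dot (J v) u by rewrite dot_J dotC.
have e3 : dot (J (C u)) v = - dot (J (C v)) u.
  by rewrite dot_J dot_C CJ dotNr opprK dotC.
rewrite /qend 2!dotBl 3!dotZl dotBl dotZl [dot (val p) v]dotC vp e1 e2 e3.
rewrite 2!dotBl 3!dotZl dotBl dotZl [dot (val p) u]dotC up; ring.
Qed.

(** The mixed terms cancel in pairs, by skewness of J and C and by their anticommutation. The three
    remaining squares each give the inner product of the horizontal parts of u and v. *)
Let dot_qend u v : dot u (val p) = 0 -> dot v (val p) = 0 ->
  dot (qend u) (qend v) =
  (r ^+ 2 + (a ^+ 2 + b ^+ 2)) * (dot u v - qeta u * qeta v).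
Proof.
move=> up vp.
have cc w w' : dot w (val p) = 0 ->
    dot (C w) (C w') = dot w w' - qeta w * qeta w'.
  by move=> wp; rewrite dot_CC wp /qeta !dot_J; ring.
have pJC w : dot (val p) (J (C w)) = 0 by rewrite dotC dot_J dot_C_J oppr0.
have JCp w : dot (J (C w)) (val p) = 0 by rewrite dotC pJC.
have pC w : dot (val p) (C w) = 0 by rewrite dotC dot_C_val.
have pJ w : dot (val p) (J w) = qeta w by rewrite dotC.
have Jp w : dot (J w) (val p) = qeta w by [].
have x1 : dot (C u) (J (C v)) = - dot (J (C u)) (C v) by rewrite dot_J opprK.
have x2 : dot (C u) (J v) = - dot (J u) (C v).
  by rewrite dot_C CJ dotNr opprK dot_J opprK.
have x3 : dot (C u) v = - dot u (C v) by rewrite dot_C.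
rewrite /qend 2!dotBl 3!dotZl dotBl dotZl.
rewrite !dotBr !dotZr !dotBr !dotZr.
rewrite !dot_JJ !cc // x1 x2 x3 !pJC !JCp !pC !dot_C_val !pJ !Jp dot_val; ring.
Qed.

Let dot_qtensor u v w : dot (qtensor u v) w =
  qeta u * dot (qend v) w - qeta v * dot (qend u) w + dot (qend u) v * dot qxi w.
Proof. by rewrite /qtensor dotDl dotBl 3!dotZl. Qed.

Lemma qtensor_alt23 u v w : dot u (val p) = 0 -> dot v (val p) = 0 ->
  dot w (val p) = 0 -> dot (qtensor u v) w = - dot (qtensor u w) v.
Proof.
move=> up vp wp; rewrite (dot_qtensor u v w) (dot_qtensor u w v) -!qeta_qxi.
have := qend_skew wp vp; move: (dot (qend w) v) => c ->; ring.
Qed.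

Lemma qtensor_alt12 u v w : dot u (val p) = 0 -> dot v (val p) = 0 ->
  dot (qtensor u v) w = - dot (qtensor v u) w.
Proof.
move=> up vp; rewrite (dot_qtensor u v w) (dot_qtensor v u w).
have := qend_skew up vp; move: (dot (qend u) v) => c ->; ring.
Qed.

Lemma qtensor_tangent u v : dot (qtensor u v) (val p) = 0.
Proof. by rewrite dot_qtensor !qend_tangent dot_qxi_val; ring. Qed.

Lemma qtensorB u v w : qtensor (u - v) w = qtensor u w - qtensor v w.
Proof.
have BE (L : 'rV[R]_6 -> 'rV[R]_6) : linear L -> L (u - v) = L u - L v.
  by move=> Ll; rewrite addrC -scaleN1r Ll scaleN1r addrC.
rewrite /qtensor (BE _ qend_linear) dotBl /qeta (BE _ J_linear) dotBl.
move: (qend u) (qend v) (qend w) qxi => fu fv fw x.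
apply/rowP => j; rewrite !mxE; ring.
Qed.

(** Write s2 for the squared coefficient. The product <F u, F v> = s2 (<u, v> - eta(u) eta(v))
    occurs twice, once from e along xi and once from the xi-component of A; the contact hyperplane,
    of dimension 5 - 1 = 4, adds 4 s2 eta(u) eta(v), and the other terms cancel. *)
Lemma sum_dot_qtensor u v : dot u (val p) = 0 -> dot v (val p) = 0 ->
  \sum_i dot (qtensor (E i p) u) (qtensor (E i p) v) =
  2 * (r ^+ 2 + (a ^+ 2 + b ^+ 2)) * (dot u v + qeta u * qeta v).
Proof.
set s2 := _ + (_ + _).
move=> up vp; have Ep i : dot (E i p) (val p) = 0 by rewrite /tfield dot_tproj_val.
have e i : dot (qtensor (E i p) u) (qtensor (E i p) v) =
    dot (qend u) (qend v) * (dot qxi (E i p) * dot qxi (E i p))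
    - s2 * qeta v * (dot qxi (E i p) * dot u (E i p))
    - s2 * qeta u * (dot qxi (E i p) * dot v (E i p))
    + 2 * s2 * (qeta u * qeta v) * (dot qxi (E i p) * dot qxi (E i p))
    + qeta u * qeta v * s2 * (dot (E i p) (E i p) - dot qxi (E i p) * dot qxi (E i p))
    + dot (qend u) (E i p) * dot (qend v) (E i p).
  rewrite -!qeta_qxi.
  (* Skewness of F moves it off the frame vector, so that the Parseval identity applies to F u and F
     v. *)
  have -> : dot (qend u) (E i p) * dot (qend v) (E i p) =
      dot (qend (E i p)) u * dot (qend (E i p)) v.
    by rewrite (qend_skew (Ep i) up) (qend_skew (Ep i) vp) mulrNN.
  apply: dot_tensor_pair; [exact: dot_qend|rewrite [dot v (E i p)]dotC; exact: dot_qend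
    |exact: dot_qend|exact: qend_horizontal..|exact: dot_qxi_qxi].
rewrite (eq_bigr _ (fun i _ => e i)) !big_split /= !sumrN -!mulr_sumr sumrB.
rewrite !sum_dot_tfield ?dot_qxi_val ?qend_tangent // sum_norm_tfield.
rewrite (dot_qend up vp) dot_qxi_qxi -!qeta_qxi -/s2; ring.
Qed.

End QuaternionicTensor.

(** * The connections of the family *)

Section Family.
Context {R : realType}.
Implicit Types (p : S5 R) (X Y Z : field R).
Local Notation E i := (tfield (delta_mx 0 i)).

Definition rq_tensor (r : R) (q : R[i]) p : 'rV[R]_6 -> 'rV[R]_6 -> 'rV[R]_6 :=
  qtensor (@muli R) (ccross (val p)) r (complex.Re q) (complex.Im q) p.

Lemma ccross_val_properties p (C := ccross (val p)) :
  [/\ forall u v, dot (C u) v = - dot u (C v),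
      forall u, C (muli u) = - muli (C u), C (val p) = 0 &
      forall u v, dot (C u) (C v) =
        dot u v - dot u (val p) * dot v (val p) - dot u (muli (val p)) * dot v (muli (val p))].
Proof.
split; [exact: dot_ccross|exact: ccross_muli|exact: ccrossxx|] => u v.
by rewrite dot_ccross2 dot_val mul1r.
Qed.

Let rq_rearrange (r a b hx hy t1 t2 t3 : R) (jx jy jcx jcy cx cy x q : 'rV[R]_6) :
  r *: (t1 *: x - hx *: (jy - hy *: q) + hy *: (jx - hx *: q))
  + a *: (hy *: jcx - hx *: jcy + t2 *: x) + b *: (hx *: cy - hy *: cx + t3 *: x) =
  hx *: (b *: cy - a *: jcy - r *: (jy - hy *: q))
  - hy *: (b *: cx - a *: jcx - r *: (jx - hx *: q)) + (b * t3 + a * t2 + r * t1) *: x.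
Proof. by apply/rowP => j; rewrite !mxE; ring. Qed.

(** All three groups of terms have the shape eta(X) F Y - eta(Y) F X + <F X, Y> xi, with F equal to
    - r psi, - Re(q) psi psihat and Im(q) psihat respectively. *)
Lemma nabla_rqE nablag r q X Y p : dot (X p) (val p) = 0 -> dot (Y p) (val p) = 0 ->
  nabla_rq nablag r q X Y p = nablag X Y p + rq_tensor r q p (X p) (Y p).
Proof.
rewrite /nabla_rq; move: (X p) (Y p) => x y xp yp.
have [dC CJ Cp _] := ccross_val_properties p.
have Jp0 : ccross (val p) (muli (val p)) = 0.
  rewrite CJ Cp; have := @muli_linear R (-1) 0 0.
  by rewrite !scaleN1r oppr0 addr0 addNr => ->; rewrite oppr0.
(* The image of [psihat] is orthogonal to i p, so multiplying it by i produces no normal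
   component. *)
have psiC u : psi p (ccross (val p) u) = muli (ccross (val p) u).
  have -> : psi p (ccross (val p) u) = muli (ccross (val p) u)
      - dot (muli (ccross (val p) u)) (val p) *: val p by [].
  by rewrite dot_muli dC Jp0 dot0r !oppr0 scale0r subr0.
have assoc (n A B C T : 'rV[R]_6) : A + B + C = T -> n + A + B + C = n + T.
  by move=> <-; rewrite !addrA.
apply: assoc; rewrite (psihatE p x) (psihatE p y) (psiC x) (psiC y).
have -> : Phi p x y = dot x (muli y) by rewrite /Phi /psi dotBr dotZr xp mulr0 subr0.
have -> : Phi p (ccross (val p) x) y = dot (ccross (val p) x) (muli y).
  by rewrite /Phi /psi dotBr dotZr (dC x (val p)) Cp dot0r oppr0 mulr0 subr0.
apply: etrans (rq_rearrange _ _ _ _ _ _ _ _ _ _ _ _ _ _ _ _) _.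
rewrite /rq_tensor /qtensor /qend; congr (_ + _ *: _).
rewrite 2!dotBl 3!dotZl dotBl dotZl [dot (val p) y]dotC yp !dot_muli; ring.
Qed.

Lemma eta_form_qeta p u : eta_form p u = qeta (@muli R) p u. Proof. by []. Qed.

Lemma rq_tensor_vf r q X Y : vector_field X -> vector_field Y ->
  vector_field (fun p => rq_tensor r q p (X p) (Y p)).
Proof.
move=> [Xs Xt] [Ys Yt].
have Js Z : smooth Z -> smooth (fun p => muli (Z p)).
  by move=> Zs; apply: smooth_lin => //; exact: muli_linear.
have Cs Z : smooth Z -> smooth (fun p => ccross (val p) (Z p)).
  move=> Zs; apply: smooth_bilin => //; [exact: ccross_linearr|exact: ccross_linearl|].
  exact: smooth_val.
have hs Z : smooth Z -> smooth (fun p => qeta (@muli R) p (Z p) : R^o).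
  by move=> Zs; apply: smooth_dot; [exact: Js|exact: smooth_val].
have cs (k : R) Z : smooth Z -> smooth (fun p => k *: Z p).
  by move=> Zs; apply: smooth_scale => //; exact: smooth_cst.
have Fs Z : smooth Z -> smooth (fun p =>
    qend (@muli R) (ccross (val p)) r (complex.Re q) (complex.Im q) p (Z p)).
  move=> Zs; apply: smooth_sub.
    by apply: smooth_sub; apply: cs; [exact: Cs|apply: Js; exact: Cs].
  apply: cs; apply: smooth_sub; first exact: Js.
  by apply: smooth_scale; [exact: hs|exact: smooth_val].
split.
  apply: smooth_add.
    by apply: smooth_sub; apply: smooth_scale; [exact: hs|exact: Fs|exact: hs|exact: Fs].
  apply: smooth_scale; first by apply: smooth_dot => //; exact: Fs.
  by apply: smooth_opp; apply: Js; exact: smooth_val.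
move=> p; have [dC CJ Cp _] := ccross_val_properties p.
exact: (qtensor_tangent _ _ _ (@muli_linear R) (@dot_muli R) dC CJ Cp).
Qed.

Lemma nabla_rq_skew_difference nablag r q : levi_civita nablag ->
  skew_difference (nabla_rq nablag r q)
    (fun X Y p => rq_tensor r q p (X p) (Y p)).
Proof.
move=> LC; split.
- move=> X Y Xv Yv; apply/funext => p; have [[_ Xt] [_ Yt]] := (Xv, Yv).
  by rewrite nabla_rqE // (levi_civitaE LC).
- exact: rq_tensor_vf.
- move=> X X' Y p _ _ _; have [dC CJ Cp _] := ccross_val_properties p.
  exact: qtensorB (@muli_linear R) (ccross_linearr _) _ _ _.
- move=> X Y Z p [_ Xt] [_ Yt] [_ Zt]; have [dC CJ Cp _] := ccross_val_properties p.
  exact (@qtensor_alt23 R _ _ r _ _ p (@dot_muli R) dC CJ _ _ _ (Xt p) (Yt p) (Zt p)).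
- move=> X Y Z p [_ Xt] [_ Yt] [_ Zt]; have [dC CJ Cp _] := ccross_val_properties p.
  exact (@qtensor_alt12 R _ _ r _ _ p (@dot_muli R) dC CJ _ _ _ (Xt p) (Yt p)).
Qed.

Lemma SymRic_nabla_rq nablag r q Y Z p : levi_civita nablag ->
  vector_field Y -> vector_field Z ->
  SymRic (nabla_rq nablag r q) Y Z p =
  (4 - 2 * (r ^+ 2 + ComplexField.Normc.normc q ^+ 2)) * dot (Y p) (Z p)
  - 2 * (r ^+ 2 + ComplexField.Normc.normc q ^+ 2)
      * (eta_form p (Y p) * eta_form p (Z p)).
Proof.
move=> LC Yv Zv; have [[_ Yt] [_ Zt]] := (Yv, Zv).
rewrite (SymRic_skew p (nabla_rq_skew_difference r q LC) Yv Zv).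
have [dC CJ Cp CC] := ccross_val_properties p.
have -> : ComplexField.Normc.normc q ^+ 2 = complex.Re q ^+ 2 + complex.Im q ^+ 2.
  by case: q => a b; rewrite /= sqr_sqrtr // addr_ge0 // sqr_ge0.
have := @sum_dot_qtensor R (@muli R) (ccross (val p)) r (complex.Re q) (complex.Im q) p.
move=> /(_ (@muli_linear R) (@muliK R) (@dot_muli R) dC CJ Cp CC _ _ (Yt p) (Zt p)).
rewrite /rq_tensor => ->.
rewrite !eta_form_qeta.
move: (dot _ _) (qeta _ _ _) (qeta _ _ _) (_ + _ ^+ 2) => *; ring.
Qed.

End Family.

(** * Invariant Einstein connections *)

Section AlternatingForm.
Context {R : realType}.
Implicit Types x y z : 'rV[R]_6.
Variables (a : 'rV[R]_6 -> 'rV[R]_6 -> 'rV[R]_6 -> R) (q xi : 'rV[R]_6) (mu : R).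
Local Notation e i := (delta_mx 0 i : 'rV[R]_6).

Hypothesis a_linear : forall k x x' y z, a (k *: x + x') y z = k * a x y z + a x' y z.
Hypothesis a_alt12 : forall x y z, a y x z = - a x y z.
Hypothesis a_alt23 : forall x y z, a x z y = - a x y z.
Hypothesis a_normal : forall y z, a q y z = 0.
Hypotheses (qq : dot q q = 1) (q_xi : dot q xi = 0) (xixi : dot xi xi = 1).
Hypothesis a_horizontal : forall x y z,
  dot x q = 0 -> dot x xi = 0 -> dot y q = 0 -> dot y xi = 0 ->
  dot z q = 0 -> dot z xi = 0 -> a x y z = 0.
Hypothesis a_einstein : forall y, dot y q = 0 ->
  \sum_i \sum_j a (e i) y (e j) * a (e i) y (e j) = mu * dot y y.

Let hor x := x - dot x q *: q - dot x xi *: xi.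

Let hor_q x : dot (hor x) q = 0.
Proof. by rewrite /hor !dotBl !dotZl qq [dot xi q]dotC q_xi; ring. Qed.

Let hor_xi x : dot (hor x) xi = 0.
Proof. by rewrite /hor !dotBl !dotZl xixi q_xi; ring. Qed.

Let a0 y z : a 0 y z = 0.
Proof. by have := a_linear (-1) 0 0 y z; rewrite scaler0 addr0; lra. Qed.

Let a_cyc x y z : a x y z = a y z x.
Proof. by rewrite -[RHS]opprK -a_alt23 -a_alt12. Qed.

Let a_hor x y z : a x y z = dot x xi * a xi y z + a (hor x) y z.
Proof.
have {1}-> : x = dot x q *: q + (dot x xi *: xi + hor x).
  by rewrite /hor [dot x xi *: xi + _]addrC subrK addrC subrK.
by rewrite !a_linear a_normal mulr0 add0r.
Qed.

Let a_xixi z : a xi xi z = 0.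
Proof. by have := a_alt12 xi xi z; lra. Qed.

Let a_xi_hor x y : a xi (hor x) y = a xi x y.
Proof.
by rewrite -[RHS]opprK -a_alt12 [in RHS]a_hor a_xixi mulr0 add0r (a_alt12 xi) opprK.
Qed.

Let a_xi_hor2 x y : a xi x (hor y) = a xi x y.
Proof. by rewrite a_alt23 a_xi_hor -a_alt23. Qed.

(** This is a = eta /\ b with b = a(xi, ., .): the xi-part of each argument is split off in turn,
    and the purely horizontal remainder vanishes by hypothesis. *)
Let a_decomp x y z :
  a x y z = dot x xi * a xi y z + dot y xi * a xi z x + dot z xi * a xi x y.
Proof.
rewrite a_hor (a_cyc (hor x)) (a_hor y) a_xi_hor2 (a_cyc (hor y)) (a_hor z).
by rewrite a_xi_hor a_xi_hor2 (a_horizontal (x := hor z)) // addr0 addrA.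
Qed.

Let a_sum x y z : a x y z = \sum_i x 0 i * a (e i) y z.
Proof.
have {1}-> : x = \sum_i x 0 i *: e i by exact: row_sum_delta.
elim: (index_enum _) => [|i r IH]; first by rewrite !big_nil a0.
by rewrite !big_cons a_linear IH.
Qed.

Let N := \sum_i \sum_j a xi (e i) (e j) * a xi (e i) (e j).

(** This is the trace hypothesis at y = xi. *)
Let N_mu : N = mu.
Proof.
rewrite -[mu]mulr1 -xixi -a_einstein; last by rewrite dotC.
by apply: eq_bigr => i _; apply: eq_bigr => j _; rewrite (a_alt12 xi) mulrNN.
Qed.

(** This is the trace hypothesis at the horizontal part of e_k, whose squared norm is the factor on
    the right. With c = b(e_k, .), the form becomes xi_i c_j - xi_j c_i there; its squared norm is 2
    |c|^2 because c is orthogonal to the unit vector xi. *)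
Let row_norm k : 2 * \sum_j a xi (e k) (e j) * a xi (e k) (e j) =
  N * (1 - q 0 k * q 0 k - xi 0 k * xi 0 k).
Proof.
pose c j := a xi (e k) (e j).
have hk : dot (hor (e k)) (hor (e k)) = 1 - q 0 k * q 0 k - xi 0 k * xi 0 k.
  rewrite {2}/hor !dotBr !dotZr hor_q hor_xi /hor !dotBl !dotZl !mulr0 !subr0.
  by rewrite (dotC (e k) q) (dotC (e k) xi) !dot_delta mxE !eqxx.
have ce i j : a (e i) (hor (e k)) (e j) = xi 0 i * c j - xi 0 j * c i.
  rewrite a_decomp hor_xi mul0r addr0 !(dotC _ xi) !dot_delta.
  rewrite (a_alt23 xi (hor _) (e i)) !a_xi_hor /c; ring.
have xc : \sum_j xi 0 j * c j = 0.
  apply: etrans (a_xixi (e k)); rewrite [RHS]a_sum.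
  apply: eq_bigr => j _; congr (_ * _); rewrite /c.
  by rewrite -a_cyc.
have cc : \sum_j c j * c j = \sum_j a xi (e k) (e j) * a xi (e k) (e j) by [].
have := a_einstein (hor_q (e k)); rewrite hk -N_mu => <-; rewrite -cc.
have xx : \sum_j xi 0 j * xi 0 j = 1 by rewrite -dotE.
have inner i : \sum_j a (e i) (hor (e k)) (e j) * a (e i) (hor (e k)) (e j) =
    c i * c i + xi 0 i * xi 0 i * \sum_j c j * c j.
  rewrite (eq_bigr (fun j => c i * c i * (xi 0 j * xi 0 j)
     - 2 * (xi 0 i * c i) * (xi 0 j * c j) + xi 0 i * xi 0 i * (c j * c j))); last first.
    by move=> j _; rewrite ce; ring.
  by rewrite big_split /= sumrB -!mulr_sumr xx xc mulr1 mulr0 subr0.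
rewrite (eq_bigr _ (fun i _ => inner i)) big_split -mulr_suml xx /=; ring.
Qed.

Lemma alternating_einstein_eq0 x y z : a x y z = 0.
Proof.
have N0 : N = 0.
  (* Summing over k, the horizontal parts of the basis vectors contribute 6 - 1 - 1 = 4. *)
  have : 2 * N = N * 4.
    rewrite {1}/N mulr_sumr (eq_bigr _ (fun k _ => row_norm k)) -mulr_sumr !sumrB.
    by rewrite -!dotE qq xixi sumr_const card_ord -[1]/(1%:R); congr (_ * _); ring.
  lra.
have b0 i j : a xi (e i) (e j) = 0.
  have pos i' : 0 <= \sum_j' a xi (e i') (e j') * a xi (e i') (e j').
    by apply: sumr_ge0 => j' _; rewrite -expr2 sqr_ge0.
  have /eqP := N0; rewrite psumr_eq0 // => /allP /(_ i (mem_index_enum _)) /=.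
  rewrite psumr_eq0 => [|j' _]; last by rewrite -expr2 sqr_ge0.
  by move=> /allP /(_ j (mem_index_enum _)) /=; rewrite mulf_eq0 orbb => /eqP.
have b y' z' : a xi y' z' = 0.
  rewrite a_cyc a_sum big1 // => i _; rewrite a_cyc a_sum big1 ?mulr0 // => j _.
  by rewrite a_cyc b0 mulr0.
by rewrite a_decomp !b !mulr0 !addr0.
Qed.

End AlternatingForm.

(** * Reflections in SU(3) *)

Lemma det_mx33 (F : comNzRingType) (M : 'M[F]_3)
    (m := fun j k => M (inord j) (inord k)) :
  \det M = m 0 0 * (m 1 1 * m 2 2 - m 1 2 * m 2 1)
          - m 0 1 * (m 1 0 * m 2 2 - m 1 2 * m 2 0)
          + m 0 2 * (m 1 0 * m 2 1 - m 1 1 * m 2 0).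
Proof.
have i0 : inord 0 = 0 :> 'I_3 by apply: val_inj; rewrite /= inordK.
have i1 : inord 1 = lift ord0 ord0 :> 'I_3 by apply: val_inj; rewrite /= inordK.
have i2 : inord 2 = lift ord0 (lift ord0 ord0) :> 'I_3.
  by apply: val_inj; rewrite /= inordK.
have l1 : lift (lift ord0 ord0) ord0 = 0 :> 'I_3 by apply: val_inj.
have l2 : lift (lift ord0 ord0) (lift ord0 ord0) = lift ord0 (lift ord0 ord0) :> 'I_3.
  by apply: val_inj.
have l3 : lift (lift ord0 (lift ord0 ord0)) ord0 = 0 :> 'I_3 by apply: val_inj.
have l4 : lift (lift ord0 (lift ord0 ord0)) (lift ord0 ord0) = lift ord0 ord0 :> 'I_3.
  by apply: val_inj.
have k1 : lift (lift ord0 ord0) ord0 = 0 :> 'I_2 by apply: val_inj.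
rewrite /m i0 i1 i2 (expand_det_row _ ord0) !big_ord_recl big_ord0 /cofactor.
rewrite !(expand_det_row _ ord0) !big_ord_recl !big_ord0 /cofactor !det_mx11 !mxE.
rewrite /= !(l1, l2, l3, l4, k1) /bump /= !(expr0, expr1, expr2, exprS).
ring.
Qed.

Lemma hermitian_reflection_SU3 (R : realType) (z : 'cV[R[i]]_3)
    (w := (map_mx conjc z)^T) : w *m z = 1%:M -> SU3 (2%:R *: (z *m w) - 1%:M).
Proof.
move=> wz; set s := _ - _.
have sE i j : s i j = 2%:R * (z i 0 * conjc (z j 0)) - (i == j)%:R.
  by rewrite !mxE big_ord1 !mxE.
split.
  apply/unitarymxP.
  (* The matrix is Hermitian, so unitarity amounts to its being an involution. *)
  have -> : map_mx Num.conj s^T = s.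
    apply/matrixP => i j; rewrite mxE mxE !sE eq_sym.
    rewrite -[Num.conj _]/(conjc _) rmorphB !rmorphM !rmorph_nat /= conjcK.
    by rewrite [_ * z i 0]mulrC.
  rewrite {1}/s mulmxBl mul1mx -scalemxAl -mulmxA.
  have -> : w *m s = w.
    rewrite /s mulmxBr mulmx1 -scalemxAr mulmxA wz mul1mx.
    by rewrite scaler_nat mulr2n addrK.
  by rewrite /s opprB addrC subrK.
have w1 : conjc (z (inord 0) 0) * z (inord 0) 0 + conjc (z (inord 1) 0) * z (inord 1) 0
        + conjc (z (inord 2) 0) * z (inord 2) 0 = 1.
  have := congr1 (fun A : 'M[R[i]]_(1, 1) => A 0 0) wz.
  rewrite !mxE eqxx (eq_bigr (fun j : 'I_3 => conjc (z (inord j) 0) * z (inord j) 0)).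
    by rewrite !big_ord_recl big_ord0 /= /bump /= addr0 addrA.
  by move=> j _; rewrite inord_val !mxE.
rewrite det_mx33 !sE -!val_eqE /= !inordK //=.
move: (conjc (z _ 0)) (conjc (z _ 0)) (conjc (z _ 0)) w1 => w0 w1 w2.
move: (z _ 0) (z _ 0) (z _ 0) => z0 z1 z2 h.
(* The rank-one determinant formula det(2 z w - 1) = (-1)^3 (1 - 2 w z), as a polynomial identity;
   the eigenvalues are 1, -1, -1. *)
transitivity (- 1 + 2%:R * (w2 * z2 + w1 * z1 + w0 * z0)); first ring.
rewrite h; ring.
Qed.

Section Reflection.
Context {R : realType}.
Implicit Types (p : S5 R).

(* The element of SU(3) fixing p and acting as -1 on its complex orthogonal. *)
Definition reflection p : 'M[R[i]]_3 :=
  let z := toC (val p) in 2%:R *: (z *m (map_mx conjc z)^T) - 1%:M.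

(** Real orthogonality to both p and i p is therefore complex orthogonality to p, the form in which
    the reflection uses it. *)
Lemma toC_hermitian (u v : 'rV[R]_6) :
  ((map_mx conjc (toC u))^T *m toC v) 0 0 = Complex (dot u v) (dot v (muli u)).
Proof.
have i1 : lift ord0 ord0 = inord 1 :> 'I_3 by apply: val_inj; rewrite /= inordK.
have i2 : lift ord0 (lift ord0 ord0) = inord 2 :> 'I_3.
  by apply: val_inj; rewrite /= inordK.
have i0 : ord0 = inord 0 :> 'I_3 by apply: val_inj; rewrite /= inordK.
rewrite muli_rot !dot6E !rotE mxE !big_ord_recl big_ord0 i2 i1 i0 addr0.
rewrite /toC !mxE !inordK //=.
by apply/eqP; rewrite eq_complex /=; apply/andP; split; apply/eqP; ring.
Qed.

Lemma toC_val_unit p : (map_mx conjc (toC (val p)))^T *m toC (val p) = 1%:M.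
Proof.
apply/matrixP => i j; rewrite !ord1 toC_hermitian dot_val mxE eqxx.
have -> : dot (val p) (muli (val p)) = 0.
  by have := dot_muli (val p) (val p); rewrite [dot (val p) _]dotC; lra.
by [].
Qed.

Lemma reflection_val p : reflection p *m toC (val p) = toC (val p).
Proof.
rewrite /reflection mulmxBl -scalemxAl -mulmxA toC_val_unit mulmx1 mul1mx.
by rewrite scaler_nat mulr2n addrK.
Qed.

Lemma reflection_horizontal p u : dot u (val p) = 0 -> dot u (muli (val p)) = 0 ->
  reflection p *m toC u = - toC u.
Proof.
move=> up uJ; have zu : (map_mx conjc (toC (val p)))^T *m toC u = 0.
  by apply/matrixP => i j; rewrite !ord1 toC_hermitian dotC up uJ mxE.
by rewrite /reflection mulmxBl -scalemxAl -mulmxA zu mulmx0 scaler0 mul1mx add0r.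
Qed.

Lemma reflection_SU3 p : SU3 (reflection p).
Proof. exact: hermitian_reflection_SU3 (toC_val_unit p). Qed.

End Reflection.

(** * Equivariance under SU(3) *)

Section Action.
Context {R : realType}.
Implicit Types (p : S5 R) (X Y Z : field R) (s : 'M[R[i]]_3).

Lemma act_linear s : linear (@act R s).
Proof.
have Re_sum (f : 'I_3 -> R[i]) : complex.Re (\sum_j f j) = \sum_j complex.Re (f j).
  by apply: (big_morph (@complex.Re R)) => // -[? ?] [? ?].
have Im_sum (f : 'I_3 -> R[i]) : complex.Im (\sum_j f j) = \sum_j complex.Im (f j).
  by apply: (big_morph (@complex.Im R)) => // -[? ?] [? ?].
have toCl k (u v : 'rV[R]_6) : toC (k *: u + v) = (Complex k 0) *: toC u + toC v.
  apply/colP => j; rewrite /toC !mxE.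
  by case: j => [[|[|[|//]]] jP] /=; apply/eqP; rewrite eq_complex /=;
    apply/andP; split; apply/eqP; ring.
have ofCl k (z w : 'cV[R[i]]_3) : ofC ((Complex k 0) *: z + w) = k *: ofC z + ofC w.
  have e j : (Complex k 0 *: z + w) j 0 = Complex k 0 * z j 0 + w j 0 by rewrite !mxE.
  apply/rowP => j; rewrite /ofC [LHS]mxE !e !mxE.
  case: (z _ 0) (z _ 0) (z _ 0) (w _ 0) (w _ 0) (w _ 0) => ? ? [? ?] [? ?] [? ?] [? ?] [? ?].
  by case: j => [[|[|[|[|[|[|//]]]]]] jP] /=; ring.
by move=> k u v; rewrite /act toCl mulmxDr -scalemxAr ofCl.
Qed.

Lemma act_invmxK s u : SU3 s -> act s (act (invmx s) u) = u.
Proof.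
by move=> [su _]; rewrite /act ofCK mulmxA mulmxV ?unitarymx_unit // mul1mx toCK.
Qed.

Lemma act_mxVK s u : SU3 s -> act (invmx s) (act s u) = u.
Proof.
by move=> [su _]; rewrite /act ofCK mulmxA mulVmx ?unitarymx_unit // mul1mx toCK.
Qed.

Lemma tau_vf s X : SU3 s -> vector_field X -> vector_field (tau s X).
Proof.
move=> sS [[U [F [Uo Up Fk FX]]] Xt]; split.
  exists (act (invmx s) @^-1` U), (act s \o F \o act (invmx s)); split.
  - apply: open_comp => // x _; apply: differentiable_continuous.
    by have [] := linear_rV_is_diff x (act_linear (invmx s)).
  - by move=> p; rewrite /= -(retr_act p sS).
  - move=> k; apply: Ck_on_comp_lin => //; first exact: act_linear.
    by apply: Ck_on_lin_comp => //; exact: act_linear.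
  - by move=> p; rewrite /tau -FX (retr_act p sS).
move=> p; have [su _] := sS; rewrite -{1}(act_invmxK (val p) sS) /tau dot_act //.
by have := Xt (retr (act (invmx s) (val p))); rewrite (retr_act p sS).
Qed.

Section FixedPoint.
Variables (s : 'M[R[i]]_3) (p : S5 R).
Hypotheses (sS : SU3 s) (sp : act s (val p) = val p).

Let sVp : act (invmx s) (val p) = val p.
Proof. by rewrite -{1}sp act_mxVK. Qed.

Lemma tau_fixed X : tau s X p = act s (X p).
Proof. by rewrite /tau sVp retr_val. Qed.

(** If F extends Y, then s F s^-1 extends the transported field, and the chain rule applies to it.
    At a fixed point of s all values lie over the same p, and the normal term is preserved because s
    is an isometry. *)
Lemma nabla0_tau X Y : vector_field X -> vector_field Y ->
  nabla0 (tau s X) (tau s Y) p = act s (nabla0 X Y p).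
Proof.
move=> Xv Yv; have [[Xs Xt] [Ys Yt]] := (Xv, Yv); have [su _] := sS.
have [F Fd FY] := smooth_diff_ext p Ys.
rewrite /nabla0 tau_fixed; rewrite [tau s Y p]tau_fixed dot_act //.
have [_ tXt] := tau_vf sS Xv.
have Fd' : differentiable F (act (invmx s) (val p)) by rewrite sVp.
have [Id Ie] := linear_rV_is_diff (val p) (act_linear (invmx s)).
have Gd : differentiable (F \o act (invmx s)) (val p) by exact: differentiable_comp.
have [Sd Se] := linear_rV_is_diff ((F \o act (invmx s)) (val p)) (act_linear s).
have e q : (act s \o (F \o act (invmx s))) (val q) = tau s Y q.
  by rewrite /tau -FY (retr_act q sS).
rewrite (D_ext (tXt p) e); last exact: differentiable_comp.
rewrite (derive_comp _ Gd Sd) (deriveE _ Sd) Se.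
rewrite (derive_comp _ Id Fd') (deriveE _ Id) Ie tau_fixed act_mxVK // sVp.
rewrite -(D_ext (Xt p) FY Fd) [in RHS]addrC act_linear sp.
exact: addrC.
Qed.

End FixedPoint.
End Action.

(** * The difference tensor of an invariant connection *)

Section Rigidity.
Context {R : realType}.
Implicit Types (p : S5 R) (X Y Z : field R) (nabla : field R -> field R -> field R).
Local Notation E i := (tfield (delta_mx 0 i)).

Definition conn_diff nabla X Y : field R := fun p => nabla X Y p - nabla0 X Y p.

Lemma ofCN (z : 'cV[R[i]]_3) : ofC (- z) = - ofC z.
Proof.
apply/rowP => j; rewrite !mxE.
case: (z _ 0) (z _ 0) (z _ 0) => ? ? [? ?] [? ?].
by case: j => [[|[|[|[|[|[|//]]]]]] jP].
Qed.

Lemma tproj_linear p : linear (tproj p).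
Proof.
move=> k u v; rewrite /tproj dotDl dotZl.
move: (dot u (val p)) (dot v (val p)) => s t; apply/rowP => j; rewrite !mxE; ring.
Qed.

Lemma tfield_tangent p u : dot u (val p) = 0 -> tfield u p = u.
Proof. exact: tproj_tangent. Qed.

Lemma tproj_sum p u : dot u (val p) = 0 -> u = \sum_i u 0 i *: E i p.
Proof.
move=> up; rewrite -{1}(tproj_tangent up); exact: linear_rV_sum (tproj_linear p) u.
Qed.

(** The coefficients are global and smooth, so linearity over smooth functions yields dependence on
    the value at p alone. *)
Lemma vf_frame X : vector_field X -> X = fun q => \sum_i X q 0 i *: E i q.
Proof. by move=> [_ Xt]; apply/funext => q; exact: tproj_sum. Qed.

Lemma nabla_frame nabla (r : seq 'I_6) (f : 'I_6 -> S5 R -> R^o) Y :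
  affine_connection nabla -> (forall i, smooth (f i)) -> vector_field Y ->
  nabla (fun q => \sum_(i <- r) f i q *: E i q) Y =
  fun q => \sum_(i <- r) f i q *: nabla (E i) Y q.
Proof.
move=> an fs Yv; elim: r => [|i r IH].
  transitivity (nabla (fun q => (0 : R) *: Y q) Y).
    by congr (nabla _ Y); apply/funext => q; rewrite big_nil scale0r.
  rewrite (conn_scalel an (f := fun=> 0)) //; last exact: smooth_cst.
  by apply/funext => q; rewrite big_nil scale0r.
have Ev j := tfield_vf (delta_mx 0 j : 'rV[R]_6).
have sv : vector_field (fun q => \sum_(j <- r) f j q *: E j q : 'rV[R]_6).
  split; first by apply: smooth_sum => j; apply: smooth_scale => //; have [] := Ev j.
  move=> q; rewrite dot_suml big1 // => j _.
  by have [_ t] := Ev j; rewrite dotZl t mulr0.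
transitivity (nabla (fun q => f i q *: E i q + \sum_(j <- r) f j q *: E j q) Y).
  by congr (nabla _ Y); apply/funext => q; rewrite big_cons.
rewrite (conn_addl an) //; last exact: vf_scale.
rewrite IH (conn_scalel an) //; by apply/funext => q; rewrite big_cons.
Qed.

Lemma nabla0_frame X Y p : dot (X p) (val p) = 0 -> smooth Y ->
  nabla0 X Y p = \sum_i X p 0 i *: nabla0 (E i) Y p.
Proof.
move=> Xp /(smooth_diff_ext p)[F Fd FY].
have Ep i : dot (E i p) (val p) = 0 by exact: dot_tproj_val.
rewrite /nabla0 (D_ext Xp FY Fd) (deriveE _ Fd).
under [RHS]eq_bigr => i _ do rewrite (D_ext (Ep i) FY Fd) (deriveE _ Fd) scalerDr scalerA -dotZl.
rewrite big_split /= -scaler_suml -dot_suml -(tproj_sum Xp); congr (_ + _).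
by rewrite {1}(tproj_sum Xp) linear_sum; apply: eq_bigr => i _; rewrite linearZ.
Qed.

Let alt13_of_alt23 (a b c d : R) : a = - b -> a - d = - (b - c) -> c = - d.
Proof. by move=> ->; lra. Qed.

Let odd_of_linear (a b c : R) : c = -1 * c + c -> b = -1 * a + c -> b = - a.
Proof. by lra. Qed.

Section Connection.
Variable nabla : field R -> field R -> field R.
Hypotheses (an : affine_connection nabla) (mn : metric nabla).
Hypothesis tn : skew_torsion nabla.
Local Notation A := (conn_diff nabla).

Let A_vf X Y : vector_field X -> vector_field Y -> vector_field (A X Y).
Proof.
by move=> Xv Yv; apply: vf_sub; [exact: (conn_vf an)|exact: nabla0_vf].
Qed.

Let A_frame X Y p : vector_field X -> vector_field Y ->
  A X Y p = \sum_i X p 0 i *: A (E i) Y p.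
Proof.
move=> Xv Yv; have [[Xs Xt] [Ys Yt]] := (Xv, Yv).
rewrite /conn_diff (nabla0_frame (Xt p) Ys) {1}(vf_frame Xv).
rewrite (@nabla_frame nabla _ (fun i q => X q 0 i : R^o) Y an) //; last first.
  by move=> i; exact: smooth_coord.
by rewrite -sumrB; apply: eq_bigr => i _; rewrite scalerBr.
Qed.

Let A_alt23 X Y Z p : vector_field X -> vector_field Y -> vector_field Z ->
  dot (A X Y p) (Z p) = - dot (A X Z p) (Y p).
Proof.
move=> Xv Yv Zv; have := mn Xv Yv Zv p; rewrite (nabla0_metric Xv Yv Zv) /g.
rewrite /conn_diff !dotBl ![dot (Y p) _]dotC.
move: (dot _ _) (dot _ _) (dot _ _) (dot _ _) => a b c d; lra.
Qed.

(** Skewness of the torsion in its last two slots, combined with that of A, gives skewness of A in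
    slots 1 and 3. The transpositions (13) and (23) generate (12). *)
Let A_alt12 X Y Z p : vector_field X -> vector_field Y -> vector_field Z ->
  dot (A X Y p) (Z p) = - dot (A Y X p) (Z p).
Proof.
have tE B C F : dot (torsion nabla B C p) (F p) = dot (A B C p) (F p) - dot (A C B p) (F p).
  rewrite -dotBl; congr dot; rewrite /torsion lieE /conn_diff.
  move: (nabla B C p) (nabla C B p) (nabla0 B C p) (nabla0 C B p) => s t u v.
  by apply/rowP => j; rewrite !mxE; ring.
have alt13 B C F : vector_field B -> vector_field C -> vector_field F ->
    dot (A C B p) (F p) = - dot (A F B p) (C p).
  move=> Bv Cv Fv; have [_ _ skew23 _ _] := tn Bv Cv Fv.
  have skew : dot (torsion nabla B F p) (C p) = - dot (torsion nabla B C p) (F p).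
    exact: skew23.
  apply: alt13_of_alt23 (A_alt23 p Bv Fv Cv) _.
  exact: etrans (etrans (esym (tE B F C)) skew) (congr1 -%R (tE B C F)).
move=> Xv Yv Zv; rewrite (A_alt23 p Xv Yv Zv) (alt13 Z X Y) // opprK.
by rewrite (A_alt23 p Yv Zv Xv).
Qed.

Lemma conn_diff_skew : skew_difference nabla A.
Proof.
split=> //.
- by move=> X Y _ _; apply/funext => p; rewrite /conn_diff addrC subrK.
- move=> X X' Y p Xv Xv' Yv; have Sv := vf_sub Xv Xv'.
  rewrite (A_frame p Sv Yv) (A_frame p Xv Yv) (A_frame p Xv' Yv) -sumrB.
  by apply: eq_bigr => i _; rewrite -scalerBl !mxE.
Qed.

(** The tensor is read on all of R^6 by projecting each argument to the tangent space at p; it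
    therefore vanishes as soon as an argument is normal. *)
Definition conn_form p (x y z : 'rV[R]_6) : R :=
  dot (A (tfield x) (tfield y) p) (tfield z p).

Let A_pointwise X Y p : vector_field X -> vector_field Y ->
  A X Y p = A (tfield (X p)) Y p.
Proof.
move=> Xv Yv; have [_ Xt] := Xv.
rewrite (A_frame p Xv Yv) (A_frame p (tfield_vf (X p)) Yv).
by rewrite (tfield_tangent (Xt p)).
Qed.

(** The first slot depends on X p by the frame expansion; alternation exchanges the slots and
    extends this to the second, and the third is an inner product at p. *)
Let conn_formE X Y Z p : vector_field X -> vector_field Y -> vector_field Z ->
  dot (A X Y p) (Z p) = conn_form p (X p) (Y p) (Z p).
Proof.
move=> Xv Yv Zv; have [[_ Xt] [_ Yt] [_ Zt]] := And3 Xv Yv Zv.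
have tv (w : 'rV[R]_6) := tfield_vf w; rewrite /conn_form (A_pointwise p Xv Yv).
rewrite (A_alt12 p (tv _) Yv Zv) (A_pointwise p Yv (tv _)).
apply: etrans (esym (A_alt12 p (tv (X p)) (tv (Y p)) Zv)) _.
by rewrite (tfield_tangent (Zt p)).
Qed.

Let conn_form_linear p k x x' y z :
  conn_form p (k *: x + x') y z = k * conn_form p x y z + conn_form p x' y z.
Proof.
have tv (w : 'rV[R]_6) := tfield_vf w; rewrite /conn_form -dotZl -dotDl; congr dot.
rewrite (A_frame p (tv (k *: x + x')) (tv y)) (A_frame p (tv x) (tv y)).
rewrite (A_frame p (tv x') (tv y)) scaler_sumr -big_split; apply: eq_bigr => i _ /=.
rewrite scalerA -scalerDl; congr (_ *: _).
by rewrite -[tfield (_ + _) p]/(tproj p _) tproj_linear mxE [X in X + _]mxE.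
Qed.

Let alt12 p x y z : conn_form p y x z = - conn_form p x y z.
Proof. exact: A_alt12 (tfield_vf _) (tfield_vf _) (tfield_vf _). Qed.

Let alt23 p x y z : conn_form p x z y = - conn_form p x y z.
Proof. exact: A_alt23 (tfield_vf _) (tfield_vf _) (tfield_vf _). Qed.

Hypothesis inv : su3_invariant nabla.

(* The reflection fixes p and is -1 on the contact hyperplane, so an invariant
   form of odd degree vanishes there. *)
Let conn_form_horizontal p x y z :
  dot x (val p) = 0 -> dot x (xi p) = 0 -> dot y (val p) = 0 -> dot y (xi p) = 0 ->
  dot z (val p) = 0 -> dot z (xi p) = 0 -> conn_form p x y z = 0.
Proof.
move=> xp xxi yp yxi zp zxi; pose s := reflection p.
have sS : SU3 s by exact: reflection_SU3.
have sp : act s (val p) = val p by rewrite /act reflection_val toCK.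
have neg w : dot w (val p) = 0 -> dot w (xi p) = 0 -> tau s (tfield w) p = - w.
  move=> wp wxi; rewrite tau_fixed // (tfield_tangent wp) /act.
  rewrite reflection_horizontal //; last first.
    by apply/eqP; rewrite -oppr_eq0 -dotNr -/(xi p) wxi.
  by rewrite ofCN toCK.
have tv (w : 'rV[R]_6) := tfield_vf w; have ttv w := tau_vf sS (tv w).
have AE : A (tau s (tfield x)) (tau s (tfield y)) p = act s (A (tfield x) (tfield y) p).
  rewrite /conn_diff (nabla0_tau sS sp (tv x) (tv y)) -(inv sS (tv x) (tv y)).
  rewrite tau_fixed // addrC -scaleN1r -act_linear; congr act.
  by rewrite scaleN1r addrC.
have [su _] := sS.
have : conn_form p (- x) (- y) (- z) = conn_form p x y z.
  have <- := neg x xp xxi; have <- := neg y yp yxi; have <- := neg z zp zxi.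
  rewrite -(conn_formE p (ttv x) (ttv y) (ttv z)) AE tau_fixed // dot_act //.
have cN u v w : conn_form p (- u) v w = - conn_form p u v w.
  have := conn_form_linear p (-1) u 0 v w; have := conn_form_linear p (-1) 0 0 v w.
  rewrite scaleN1r oppr0 addr0 scaleN1r addr0; exact: odd_of_linear.
(* A sign can be extracted from the first slot only, so alternation brings each argument there in
   turn; three signs give c = - c. *)
rewrite cN alt12 cN alt12 alt23 alt12 cN alt12 alt23.
by move: (conn_form _ _ _ _) => c; lra.
Qed.

Lemma invariant_Einstein_eq X Y : Einstein nabla ->
  vector_field X -> vector_field Y -> nabla X Y = nabla0 X Y.
Proof.
move=> [_ _ eins] Xv Yv; apply/funext => p; apply/eqP; rewrite -subr_eq0; apply/eqP.
have [_ At] := A_vf Xv Yv; have tv (w : 'rV[R]_6) := tfield_vf w; apply: dot_eq0.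
have -> : nabla X Y p - nabla0 X Y p = tfield (A X Y p) p by rewrite tfield_tangent.
rewrite {1}(tfield_tangent (At p)) (conn_formE p Xv Yv (tv _)).
have vxi : dot (val p) (xi p) = 0.
  by rewrite /xi dotNr; have := dot_muli (val p) (val p); rewrite [dot (muli _) _]dotC; lra.
(* The constant mu comes from solving 4 |y|^2 - sum_i |A(E_i, y)|^2 = (scal / 5) |y|^2 for the
   sum. *)
apply: (@alternating_einstein_eq0 R (conn_form p) (val p) (xi p) (4 - scal nabla p / 5)).
- by move=> *; exact: conn_form_linear.
- by move=> *; exact: alt12.
- by move=> *; exact: alt23.
- move=> u v; rewrite /conn_form (A_frame p (tv _) (tv _)) big1 ?dot0l // => i _.
  by rewrite {1}/tfield /tproj dot_val scale1r subrr mxE scale0r.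
- exact: dot_val.
- exact: vxi.
- by rewrite /xi dotNl dotNr opprK dot_muli muliK dotNr opprK dot_val.
- by move=> *; exact: conn_form_horizontal.
move=> y yp; have := eins _ _ (tv y) (tv y) p.
rewrite (SymRic_skew p conn_diff_skew (tv y) (tv y)) /g.
rewrite (tfield_tangent yp).
have -> : \sum_i dot (A (E i) (tfield y) p) (A (E i) (tfield y) p) =
    \sum_i \sum_j conn_form p (delta_mx 0 i) y (delta_mx 0 j) *
                  conn_form p (delta_mx 0 i) y (delta_mx 0 j).
  apply: eq_bigr => i _; have [_ t] := A_vf (tv (delta_mx 0 i)) (tv y).
  by rewrite -(sum_dot_tfield (t p) (t p)).
move: (dot _ _) (\sum_i _) (scal _ _) => a b c; lra.
Qed.

End Connection.
End Rigidity.

Theorem corollary6p9 (R : realType) (nablag : field R -> field R -> field R)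
    (LC : levi_civita nablag) :
  (forall (r : R) (q : R[i]) (Y Z : field R),
     vector_field Y -> vector_field Z ->
     forall p : S5 R,
       SymRic (nabla_rq nablag r q) Y Z p =
       (4 - 2 * (r ^+ 2 + ComplexField.Normc.normc q ^+ 2)) * g Y Z p
       - 2 * (r ^+ 2 + ComplexField.Normc.normc q ^+ 2)
           * (eta_form p (Y p) * eta_form p (Z p)))
  /\
  (forall nabla : field R -> field R -> field R,
     affine_connection nabla -> su3_invariant nabla -> metric nabla ->
     ~ eq_connection nabla nablag -> ~ Einstein nabla).
Proof.
split=> [r q Y Z Yv Zv p|nabla an inv mn neq ein]; first exact: SymRic_nabla_rq.
apply: neq => X Y Xv Yv; rewrite (levi_civitaE LC) //.
by have [_ tn _] := ein; exact: invariant_Einstein_eq.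
Qed.
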